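(* Let $p$ be an odd prime number and $\mathcal{F}$ be a saturated fusion system on a finite $p$-group $S$. Suppose that there is a subgroup $D$ of $S$ with $1 < D < S$ such that every subgroup of $S$ with order $|D|$ is abelian and weakly $\mathcal{F}$-closed. Then $\mathcal{F}$ is supersolvable.
   Context: Let $p$ be a prime and $S$ a finite $p$-group. A fusion system $\mathcal{F}$ on $S$ is a category whose objects are the subgroups of $S$ and whose morphism sets $\mathrm{Hom}_{\mathcal{F}}(P,Q)$ consist of injective group homomorphisms $P \to Q$ (with usual composition), contain all homomorphisms $P \to Q$ induced by conjugation by elements of $S$, and are such that each $\varphi \in \mathrm{Hom}_{\mathcal{F}}(P,Q)$ factors as an $\mathcal{F}$-isomorphism $P \to \varphi(P)$ followed by an inclusion. Subgroups $P,Q$ are $\mathcal{F}$-conjugate if they are isomorphic in $\mathcal{F}$. $\mathcal{F}$ is saturated if every subgroup of $S$ is $\mathcal{F}$-conjugate to a subgroup $Q$ that is fully automized ($\mathrm{Aut}_S(Q) \in \mathrm{Syl}_p(\mathrm{Aut}_{\mathcal{F}}(Q))$) and receptive (each $\mathcal{F}$-isomorphism $\varphi : P \to Q$ with $P \le S$ extends to an $\mathcal{F}$-morphism $N_\varphi \to S$, where $N_\varphi = \{ g \in N_S(P) : \varphi c_g \varphi^{-1} \in \mathrm{Aut}_S(Q)\}$). A subgroup $Q \le S$ is weakly $\mathcal{F}$-closed if $\varphi(Q) = Q$ for all $\varphi \in \mathrm{Hom}_{\mathcal{F}}(Q,S)$; it is strongly $\mathcal{F}$-closed if for every $P \le Q$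 and $\varphi \in \mathrm{Hom}_{\mathcal{F}}(P,S)$ one has $\varphi(P) \le Q$. A saturated fusion system $\mathcal{F}$ on $S$ is supersolvable if there is a series $1 = S_0 \le S_1 \le \dots \le S_m = S$ of subgroups of $S$ such that $S_i$ is strongly $\mathcal{F}$-closed for all $0 \le i \le m$ and $S_{i+1}/S_i$ is cyclic for all $0 \le i < m$. *)

(* Defs.v *)
From HB Require Import structures.
From mathcomp Require Import all_boot all_fingroup all_solvable.

Set Implicit Arguments.
Unset Strict Implicit.
Unset Printing Implicit Defensive.

Import GroupScope.

(* A morphism P -> Q is represented by a function f : gT -> gT of which only
   the values on P matter ([fhom_ext]); [fhom F P Q f] says that the
   restriction of f to P lies in Hom_F(P, Q). *)
Record fusion_system (gT : finGroupType) (S : {group gT}) := FusionSystem {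
  fhom : {group gT} -> {group gT} -> pred (gT -> gT);
  fhom_ext : forall (P Q : {group gT}) (f g : gT -> gT),
    {in P, f =1 g} -> fhom P Q f -> fhom P Q g;
  fhom_obj : forall (P Q : {group gT}) f,
    fhom P Q f -> P \subset S /\ Q \subset S;
  fhom_inj : forall (P Q : {group gT}) f,
    fhom P Q f -> [/\ morphic P f, {in P &, injective f} & f @: P \subset Q];
  fhom_comp : forall (P Q R : {group gT}) f g,
    fhom P Q f -> fhom Q R g -> fhom P R (g \o f);
  (* x = 1 yields the identities and the inclusions. *)
  fhom_conj : forall (P Q : {group gT}) x,
    P \subset S -> Q \subset S -> x \in S -> P :^ x \subset Q ->
    fhom P Q (conjg^~ x);
  (* The right-hand side says that f : P -> R is an isomorphism of the
     category, where R is the subgroup f(P). *)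
  fhom_factor : forall (P Q : {group gT}) f,
    fhom P Q f ->
    exists R : {group gT},
      f @: P = R /\
      (fhom P R f /\
       exists g, [/\ fhom R P g, {in P, cancel f g} & {in R, cancel g f}])
}.

Section FusionSystems.

Variables (p : nat) (gT : finGroupType) (S : {group gT}).
Variable F : fusion_system S.
Implicit Types P Q : {group gT}.

Definition fiso P Q (f : gT -> gT) : Prop :=
  fhom F P Q f /\
  exists g, [/\ fhom F Q P g, {in P, cancel f g} & {in Q, cancel g f}].

Definition fconjugate P Q : Prop := exists f, fiso P Q f.

Definition Aut_fusion Q : {set {perm gT}} := [set a in Aut Q | fhom F Q Q a].

Lemma group_set_Aut_fusion Q : Q \subset S -> group_set (Aut_fusion Q).
Proof.
move=> sQS; apply/group_setP; split=> [|a b].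
  rewrite inE group1 /=; apply: (fhom_ext (f := conjg^~ 1)).
    by move=> x _; rewrite conjg1 perm1.
  by apply: fhom_conj; rewrite ?group1 ?conjsg1.
case/setIdP=> Aa Fa /setIdP[Ab Fb]; apply/setIdP; split; first exact: groupM.
by apply: fhom_ext (fhom_comp Fa Fb) => x _ /=; rewrite permM.
Qed.

(* Aut_S(Q) = N_S(Q) / C_S(Q), as permutations of gT supported on Q. *)
Definition Aut_by Q : {group {perm gT}} := (conj_aut Q @* 'N_S(Q))%G.

Definition fully_automized Q : Prop := Aut_by Q \in 'Syl_p(Aut_fusion Q).

(* The condition that f c_g f^-1 equals some a in Aut_S(Q) is written
   f c_g = a f on P, which avoids naming the inverse of f : P -> Q. *)
Definition Nphi P Q (f : gT -> gT) : {set gT} :=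
  [set g in 'N_S(P) |
    [exists a in Aut_by Q, [forall x in P, f (x ^ g) == a (f x)]]].

Lemma group_set_Nphi P Q f : group_set (Nphi P Q f).
Proof.
apply/group_setP; split=> [|g h].
  apply/setIdP; split; first exact: group1.
  apply/exists_inP; exists 1; first exact: group1.
  by apply/forall_inP => x _; rewrite conjg1 perm1.
case/setIdP=> Ng /exists_inP[a Aa /forall_inP fa].
case/setIdP=> Nh /exists_inP[b Ab /forall_inP fb].
apply/setIdP; split; first exact: groupM.
apply/exists_inP; exists (a * b); first exact: groupM.
apply/forall_inP => x Px; rewrite conjgM permM -(eqP (fa x Px)).
by apply: fb; rewrite memJ_norm //; case/setIP: Ng.
Qed.

Canonical Nphi_group P Q f := Group (group_set_Nphi P Q f).

Definition receptive Q : Prop :=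
  forall P f, fiso P Q f ->
    exists2 h, fhom F (Nphi_group P Q f) S h & {in P, h =1 f}.

Definition saturated : Prop :=
  forall P, P \subset S ->
    exists Q, [/\ fconjugate P Q, fully_automized Q & receptive Q].

Definition weakly_closed Q : Prop :=
  Q \subset S /\ forall f, fhom F Q S f -> f @: Q = Q.

Definition strongly_closed Q : Prop :=
  Q \subset S /\
  forall P f, P \subset Q -> fhom F P S f -> f @: P \subset Q.

(* Strongly closed subgroups are normal in S, so that each quotient below is
   the usual one even though MathComp's _ / _ does not require normality. *)
Definition supersolvable : Prop :=
  exists (m : nat) (T : nat -> {group gT}),
    [/\ T 0%N :=: 1, T m :=: S,
        forall i, (i <= m)%N -> strongly_closed (T i) &
        forall i, (i < m)%N -> T i \subset T i.+1 /\ cyclic (T i.+1 / T i)].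

End FusionSystems.

(* Main.v *)
Require Import Defs.
From HB Require Import structures.
From mathcomp Require Import all_boot all_fingroup all_solvable all_algebra.
From mathcomp Require Import finfield mxabelem.

(* Let n = |D|. If |Q| > n and a group A of automorphisms of Q leaves every
   subgroup of order n invariant, let K be the subgroup of A acting trivially
   on all A-invariant sections of order p. Since Aut(C_p) is abelian of order
   p - 1, K contains the commutators and the (p-1)-st powers of A; and K is a
   p-group, because a p'-element of K fixes all elements of order p. Hence A
   has a normal Sylow p-subgroup, and (all (p-1)-st roots of unity being in
   F_p) every A-chief factor of Q has order p.

   Every morphism of F extends to an element of Aut_F(S). By downward induction
   on |Q| and Alperin's argument, this need only be shown for Aut_F(Q), with Q
   fully automized and receptive, and it holds when Aut_F(Q) is p-closed or
   C_S(Q) is not contained in Q; this leaves the case |Q| = n, C_S(Q) <= Q.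
   Choose t of order p in Aut_S(Q) induced by an overgroup of Q of order np:
   it acts on Q as a transvection. If an element of Aut_F(Q) does not extend,
   it conjugates t to an opposite transvection s, so <t, s> acts as SL_2(p) and
   contains an involution z that centralizes t and inverts [Q, s]. As z
   centralizes t, it extends to S, where it leaves all subgroups of order n
   invariant; this forces z to act trivially on Q / C_Q(t), a contradiction as
   p is odd. Finally, an Aut_F(S)-chief series of S is the required series. *)

Set Implicit Arguments.
Unset Strict Implicit.
Unset Printing Implicit Defensive.

Import GroupScope.

(** * Automorphisms of p-groups *)

(** Descent through maximal subgroups containing [H]: each step divides the order by exactly p, so
    the order m is reached. *)
Lemma pgroup_between (gT : finGroupType) (p m : nat) (H G : {group gT}) :
  p.-group G -> H \subset G -> #|H| %| m -> m %| #|G| ->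
  exists K : {group gT}, [/\ H \subset K, K \subset G & #|K| = m].
Proof.
have [k] := ubnP #|G|; elim: k G => // k IHk G leGk pG sHG dHm dmG.
have [eqmG | neqmG] := eqVneq m #|G|; first by exists G.
have [eqHG | [M maxM sHM]] := maximal_exists sHG.
  by case/eqP: neqmG; apply/eqP; rewrite eqn_dvd dmG -eqHG.
have [sMG _] := andP (maxgroupp maxM); have iM := p_maximal_index pG maxM.
have pM := pgroupS sMG pG.
have ltMG : (#|M| < #|G|)%N by apply/proper_card/(maxgroupp maxM).
have [i def_m] := p_natP (pnat_dvd dmG pG).
have [j oG] := p_natP pG; have [l oM] := p_natP pM.
have p_gt1 : (1 < p)%N by rewrite -iM indexg_gt1 proper_subn ?(maxgroupp maxM).
have dmM : m %| #|M|.
  have ojl : j = l.+1.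
    by apply/eqP; rewrite -(eqn_exp2l _ _ p_gt1) -oG -(Lagrange sMG) iM oM expnSr.
  rewrite def_m oM dvdn_exp2l //.
  have: (m < #|G|)%N by rewrite ltn_neqAle neqmG dvdn_leq.
  by rewrite def_m oG ltn_exp2l // ojl ltnS.
have [|K [sHK sKM oK]] := IHk M _ pM sHM dHm dmM; first exact: leq_trans ltMG _.
by exists K; split; rewrite // (subset_trans sKM).
Qed.

Section AutMorphism.

Variables (gT : finGroupType) (Q : {group gT}).
Implicit Types (a : {perm gT}) (x y : gT).

Lemma AutM a : a \in Aut Q -> {in Q &, {morph a : x y / x * y}}.
Proof. by move/Aut_morphic/morphicP. Qed.

Lemma Aut1E a : a \in Aut Q -> a 1 = 1.
Proof. by move=> Aa; rewrite -(autmE Aa) morph1. Qed.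

Lemma AutV a : a \in Aut Q -> {in Q, {morph a : x / x^-1}}.
Proof. by move=> Aa x Qx /=; rewrite -(autmE Aa) morphV. Qed.

Lemma AutX k a : a \in Aut Q -> {in Q, {morph a : x / x ^+ k}}.
Proof. by move=> Aa x Qx /=; rewrite -(autmE Aa) morphX. Qed.

Lemma Aut_iter_fixed k a x y : a \in Aut Q -> x \in Q -> y \in Q ->
  a x = x * y -> a y = y -> (a ^+ k) x = x * y ^+ k.
Proof.
move=> Aa Qx Qy ax ay; elim: k => [|k IHk]; first by rewrite perm1 mulg1.
by rewrite expgSr permM IHk AutM ?groupX // ax AutX // ay expgS mulgA.
Qed.

(** Iterating [a x = x * y] up to the order of [a] gives [y ^+ #[a] = 1], and coprimality forces
    [y = 1]. *)
Lemma Aut_coprime_fixed a x y : coprime #|Q| #[a] ->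
  a \in Aut Q -> x \in Q -> y \in Q -> a x = x * y -> a y = y -> a x = x.
Proof.
move=> coQa Aa Qx Qy ax ay; rewrite ax.
have := Aut_iter_fixed #[a] Aa Qx Qy ax ay.
rewrite expg_order perm1 => /eqP; rewrite eq_mulVg1 mulKg -order_dvdn => oy.
suffices /eqP->: y == 1 by rewrite mulg1.
rewrite -order_eq1 -dvdn1 -(eqP coQa) dvdn_gcd oy andbT.
exact: order_dvdG.
Qed.

(* The p-power map of a Thompson critical subgroup is a homomorphism because
   p is odd, so [x^-1 * a x] has order dividing p once [a] fixes [x ^+ p]. *)
Lemma Aut_p'elt_fix_Ohm1 (p : nat) a : p.-group Q -> odd p ->
  a \in Aut Q -> p^'.-elt a -> (forall x, x \in Q -> x ^+ p = 1 -> a x = x) ->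
  a = 1.
Proof.
move=> pQ odd_p Aa p'a fixa.
have coQa : coprime #|Q| #[a] by apply: pnat_coprime pQ p'a.
have [K critK] := Thompson_critical pQ; have [chK sPhiZ _ _] := critK.
have sKQ := char_sub chK; have pK := pgroupS sKQ pQ.
have aK x : x \in K -> a x \in K.
  by move=> Kx; move/charP: chK => [_ /(_ _ (injm_autm Aa) (im_autm Aa)) <-];
    rewrite -(autmE Aa) mem_morphim ?(subsetP sKQ).
have sK'Z : K^`(1) \subset 'Z(K).
  by apply: subset_trans sPhiZ; rewrite (Phi_joing pK) joing_subl.
have powM x y : x \in K -> y \in K -> (x * y) ^+ p = x ^+ p * y ^+ p.
  move=> Kx Ky; have Zyx : [~ y, x] \in 'Z(K) by rewrite (subsetP sK'Z) ?mem_commg.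
  have /centerP[Kyx cyx] := Zyx.
  have Zxp : x ^+ p \in 'Z(K).
    rewrite (subsetP sPhiZ) // (Phi_joing pK) -{1}(expn1 p).
    by apply: (subsetP (joing_subr _ _)); apply: (Mho_p_elt 1) (mem_p_elt pK _).
  rewrite expMg_Rmul; try by apply/commute_sym/cyx.
  have: [~ y, x] ^+ p = 1.
    rewrite -commgX; last exact/commute_sym/cyx.
    by apply/eqP/commgP/commute_sym; case/centerP: Zxp => _; apply.
  by rewrite bin2odd // expgM => ->; rewrite expg1n mulg1.
(* Induction on the exponent: [a] fixes [x ^+ p], so [x^-1 * a x] has order dividing p and is fixed
   by hypothesis; coprime action then fixes [x]. *)
have fixK k x : x \in K -> x ^+ (p ^ k) = 1 -> a x = x.
  elim: k x => [|k IHk] x Kx xpk; first by rewrite -(expg1 x) xpk Aut1E.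
  have Qx := subsetP sKQ _ Kx; have Ky : x^-1 * a x \in K by rewrite groupM ?groupV ?aK.
  have Qy := subsetP sKQ _ Ky.
  apply: (Aut_coprime_fixed coQa Aa Qx Qy); first by rewrite mulKVg.
  apply: fixa => //; rewrite powM ?groupV ?aK // -AutX // IHk ?groupX //.
    by rewrite expgVn mulVg.
  by rewrite -expgM -expnS.
(* Automorphisms of [Q] centralizing a critical subgroup form a p-group, so the p'-element [a] is
   trivial. *)
have CKa : a \in 'C(K | [Aut Q]).
  rewrite astab_ract inE Aa; apply/astabP=> x Kx /=.
  have [k oK] := p_natP pK.
  by apply: (fixK k); rewrite // -oK; apply/eqP; rewrite -order_dvdn order_dvdG.
have pa := mem_p_elt (critical_p_stab_Aut critK pQ) CKa.
by apply/eqP; rewrite -order_eq1; apply/eqP; apply: pnat_1 pa p'a.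
Qed.

End AutMorphism.

(** * Automorphism groups acting trivially on the sections of order p *)

Lemma mem_mulVg_coset (gT : finGroupType) (M : {group gT}) x y :
  x \in 'N(M) -> y \in 'N(M) -> (x^-1 * y \in M) = (coset M x == coset M y).
Proof.
move=> Nx Ny; rewrite eq_mulVg1 -morphV // -morphM ?groupV //.
apply/idP/eqP=> [/coset_id // | ]; apply: coset_idr.
by rewrite groupM ?groupV.
Qed.

Section InvariantSubgroups.

Variables (gT : finGroupType) (Q : {group gT}) (A : {group {perm gT}}).
Hypothesis sAQ : A \subset Aut Q.
Implicit Types (H M : {group gT}) (a b : {perm gT}).

Let AutA a : a \in A -> a \in Aut Q. Proof. exact: subsetP. Qed.

Definition Astable (M : {set gT}) := [forall a in A, [forall x in M, a x \in M]].

Lemma AstableP (M : {set gT}) :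
  reflect {in A & M, forall a x, a x \in M} (Astable M).
Proof.
apply: (iffP forall_inP) => [invM a x /invM/forall_inP aM /aM // | invM a Aa].
by apply/forall_inP=> x; apply: invM.
Qed.

(** Kernel of the action of [A] on the section H/M, written with representatives to avoid an induced
    action on a quotient. *)
Definition factor_ker (H M : {set gT}) :=
  [set a in A | [forall x in H, x^-1 * a x \in M]].

Lemma factor_kerP (H M : {set gT}) a :
  reflect (a \in A /\ {in H, forall x, x^-1 * a x \in M}) (a \in factor_ker H M).
Proof. by rewrite inE; apply: (iffP andP) => -[-> /forall_inP]. Qed.

Lemma group_set_factor_ker H M : H \subset Q -> Astable H -> Astable M ->
  group_set (factor_ker H M).
Proof.
move=> sHQ /AstableP invH /AstableP invM.
apply/group_setP; split=> [|a b].
  by apply/factor_kerP; split=> // x _; rewrite perm1 mulVg.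
case/factor_kerP=> Aa aHM /factor_kerP[Ab bHM].
apply/factor_kerP; split=> [|x Hx]; first exact: groupM.
have Qx := subsetP sHQ x Hx; have Qax := subsetP sHQ _ (invH a x Aa Hx).
have ->: (a * b) x = b (x * (x^-1 * a x)) by rewrite permM mulKVg.
rewrite (AutM (AutA Ab)) //; last by rewrite groupM ?groupV.
by rewrite mulgA groupM ?bHM ?invM ?aHM.
Qed.

Variable p : nat.
Hypotheses (p_pr : prime p) (pQ : p.-group Q).

Section PrimeFactor.

Variables H M : {group gT}.
Hypotheses (sMH : M \subset H) (sHQ : H \subset Q) (iM : #|H : M| = p).
Hypotheses (invH : Astable H) (invM : Astable M).

Let maxM : maximal M H. Proof. by apply: p_index_maximal; rewrite ?iM. Qed.
Let nMH : H \subset 'N(M).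
Proof. by apply/normal_norm/(p_maximal_normal (pgroupS sHQ pQ)). Qed.
Let nM x : x \in H -> x \in 'N(M). Proof. exact: subsetP. Qed.
Let aH a x : a \in A -> x \in H -> a x \in H. Proof. by move/AstableP: invH; apply. Qed.

(** H/M is cyclic of order p, so its automorphisms are power maps; the exponent is read off from a
    generator. *)
Lemma prime_factor_power a : a \in A ->
  exists i, {in H, forall x, coset M (a x) = coset M x ^+ i}.
Proof.
move=> Aa; have oHM : #|H / M| = p by rewrite card_quotient.
have /cyclicP[c def_c] : cyclic (H / M) by apply: prime_cyclic; rewrite oHM.
have: c \in H / M by rewrite def_c cycle_id.
case/morphimP=> h Nh Hh /= def_ch.
have: coset M (a h) \in <[c]> by rewrite -def_c mem_quotient ?aH.
case/cycleP=> i def_i; exists i => x Hx.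
have: coset M x \in <[c]> by rewrite -def_c mem_quotient.
case/cycleP=> j; rewrite def_ch => /esym/eqP; rewrite -morphX //.
rewrite -mem_mulVg_coset ?groupX ?nM // => Mhx.
have Qh := subsetP sHQ _ Hh; have Qhj := groupX j Qh; have Qx := subsetP sHQ _ Hx.
have Maz : a (h ^- j * x) \in M by move/AstableP: invM; apply.
have ->: a x = a h ^+ j * a (h ^- j * x).
  by rewrite -(AutX _ (AutA Aa)) // -(AutM (AutA Aa)) ?groupM ?groupV // mulKVg.
have Naz := nM (subsetP sMH _ Maz); have Nah := nM (aH Aa Hh).
rewrite morphM ?groupX //= (coset_id Maz) mulg1.
rewrite morphX //= def_i def_ch.
rewrite mem_mulVg_coset ?groupX ?nM // in Mhx; rewrite -(eqP Mhx) morphX ?nM //=.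
by rewrite -!expgM mulnC.
Qed.

Lemma mem_factor_ker a : (a \in factor_ker H M) =
  (a \in A) && [forall x in H, coset M (a x) == coset M x].
Proof.
rewrite inE; apply: andb_id2l => Aa; apply: eq_forallb => x.
case Hx: (x \in H) => //=; rewrite mem_mulVg_coset ?nM ?aH //; exact: eq_sym.
Qed.

(** Power maps commute with one another, so commutators act trivially on H/M. *)
Lemma der1_sub_factor_ker : A^`(1) \subset factor_ker H M.
Proof.
rewrite -[factor_ker H M]/(gval (Group (group_set_factor_ker sHQ invH invM))).
rewrite gen_subG; apply/subsetP=> _ /imset2P[a b Aa Ab ->] /=.
rewrite mem_factor_ker groupR //=; apply/forall_inP=> x Hx.
have [[i ai] [j bj]] := (prime_factor_power Aa, prime_factor_power Ab).
have ->: [~ a, b] = (b * a)^-1 * (a * b) by rewrite commgEl conjgE invMg !mulgA.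
set c := (b * a)^-1; have Ac : c \in A by rewrite groupV groupM.
have Hy : c x \in H by rewrite aH.
rewrite permM; apply/eqP; rewrite -{2}(permKV (b * a) x) -/c.
by rewrite !permM bj ?aH // !ai ?aH // bj // -!expgM mulnC.
Qed.

(** The exponent i is prime to p, since otherwise [a] would map [H] into the smaller group [M];
    Fermat's little theorem then applies to i. *)
Lemma expg_predn_factor_ker a : a \in A -> a ^+ p.-1 \in factor_ker H M.
Proof.
move=> Aa; rewrite mem_factor_ker groupX //=; apply/forall_inP=> x Hx.
have [i ai] := prime_factor_power Aa.
have aki k : coset M ((a ^+ k) x) = coset M x ^+ (i ^ k).
  elim: k => [|k IHk]; first by rewrite perm1.
  by rewrite expgSr permM ai ?aH ?groupX // IHk -expgM expnSr.
have xp : coset M x ^+ p = 1.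
  by rewrite -iM -card_quotient // expg_cardG // mem_quotient.
rewrite aki -(expg_mod _ xp).
suffices co_ip : coprime i p.
  by rewrite -(totient_prime p_pr) Euler_exp_totient // expg_mod.
rewrite coprime_sym prime_coprime //; apply: contraL isT => /dvdnP[k def_i] /=.
have: a @: H \subset M.
  apply/subsetP=> _ /imsetP[y Hy ->]; apply: coset_idr; first by rewrite nM ?aH.
  by rewrite ai // def_i mulnC expgM -iM -card_quotient // expg_cardG ?expg1n ?mem_quotient.
have ltMH : (#|M| < #|H|)%N by apply/proper_card/(maxgroupp maxM).
move/subset_leq_card; rewrite (card_imset (mem H) (@perm_inj _ a)).
by rewrite leqNgt ltMH.
Qed.

End PrimeFactor.

(** The group K of the opening outline. Elements of [A] act on each invariant section of order p as
    scalars; K is the joint kernel. *)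
Definition scalar_ker := [set a in A | [forall H : {group gT}, [forall M : {group gT},
  [&& M \subset H, H \subset Q, #|H : M| == p, Astable H & Astable M]
     ==> (a \in factor_ker H M)]]].

Lemma scalar_kerP a :
  reflect (a \in A /\ forall H M, M \subset H -> H \subset Q -> #|H : M| = p ->
             Astable H -> Astable M -> a \in factor_ker H M)
          (a \in scalar_ker).
Proof.
rewrite inE; apply: (iffP andP) => [[Aa aK] | [Aa aK]]; split=> //.
  move=> H M sMH sHQ /eqP iM invH invM.
  by have /forallP/(_ M)/implyP := forallP aK H; apply; apply/and5P.
apply/forallP=> H; apply/forallP=> M; apply/implyP.
by case/and5P=> sMH sHQ /eqP iM invH invM; apply: aK.
Qed.

Lemma group_set_scalar_ker : group_set scalar_ker.
Proof.
apply/group_setP; split=> [|a b /scalar_kerP[Aa aK] /scalar_kerP[Ab bK]].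
  apply/scalar_kerP; split=> // H M sMH sHQ iM invH invM.
  exact: (group1 (Group (group_set_factor_ker sHQ invH invM))).
apply/scalar_kerP; split=> [|H M sMH sHQ iM invH invM]; first exact: groupM.
apply: (groupM (G := Group (group_set_factor_ker sHQ invH invM))).
  exact: aK.
exact: bK.
Qed.
Canonical scalar_ker_group := Group group_set_scalar_ker.

Lemma der1_sub_scalar_ker : A^`(1) \subset scalar_ker.
Proof.
apply/subsetP=> a A'a; apply/scalar_kerP; split=> [|H M sMH sHQ iM invH invM].
  exact: (subsetP (der_sub 1 A)).
exact: (subsetP (der1_sub_factor_ker sMH sHQ iM invH invM)).
Qed.

Lemma expg_predn_scalar_ker a : a \in A -> a ^+ p.-1 \in scalar_ker.
Proof.
move=> Aa; apply/scalar_kerP; split=> [|H M sMH sHQ iM invH invM].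
  exact: groupX.
exact: expg_predn_factor_ker.
Qed.

Lemma scalar_ker_normal : scalar_ker <| A.
Proof.
apply: sub_der1_normal der1_sub_scalar_ker _.
by apply/subsetP=> a /scalar_kerP[].
Qed.

End InvariantSubgroups.

(* Each coset of the Frattini subgroup has p-power size, so a p'-element
   permuting it has a fixed point there. *)
Lemma Aut_p'elt_Phi (gT : finGroupType) (Q H : {group gT}) (p q : nat) (a : {perm gT}) :
  p.-group H -> H \subset Q -> a \in Aut Q -> prime q -> q != p -> #[a] = q ->
  {in 'Phi(H), forall x, a x \in 'Phi(H)} ->
  {in H, forall x, x^-1 * a x \in 'Phi(H)} ->
  {in H, forall x, a x = x}.
Proof.
move=> pH sHQ Aa q_pr q'p oa aPhi aH.
have QH x (Hx : x \in H) : x \in Q := subsetP sHQ x Hx.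
have sPhiH := Phi_sub H.
pose C := [set x in H | a x == x].
have gC : group_set C.
  apply/group_setP; split=> [|x y]; first by rewrite inE group1 (Aut1E Aa) /=.
  case/setIdP=> Hx /eqP ax /setIdP[Hy /eqP ay].
  by rewrite inE groupM //= (AutM Aa) ?QH // ax ay.
(* Elements of the Frattini subgroup are non-generators, so it is enough that each of its cosets in
   [H] contains a fixed point. *)
suffices defH : 'Phi(H) <*> C = H.
  move=> x; rewrite -{1}(Phi_nongen defH) -[C]/(gval (Group gC)) genGid.
  by case/setIdP=> _ /eqP.
  apply/eqP; rewrite eqEsubset join_subG sPhiH /=.
  apply/andP; split; first by apply/subsetP=> x /setIdP[].
  apply/subsetP=> x Hx.
  pose X := x *: 'Phi(H).
  have qa : q.-group <[a]> by rewrite /pgroup -orderE oa pnat_id.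
  have actX : [acts <[a]>, on X | 'P].
    rewrite cycle_subG; apply/astabsP=> y; rewrite /= /aperm.
    suffices sXX : {in X, forall z, a z \in X}.
      apply/idP/idP => [|/sXX //].
      have/eqP defX : a @: X == X.
        rewrite eqEcard card_imset ?leqnn ?andbT; last exact: perm_inj.
        by apply/subsetP=> _ /imsetP[z Xz ->]; apply: sXX.
      by rewrite -{1}defX => /imsetP[z Xz /perm_inj->].
    move=> _ /lcosetP[f Ff ->]; have Hf := subsetP sPhiH f Ff.
    rewrite mem_lcoset (AutM Aa) ?QH // mulgA groupM ?aPhi //.
    exact: aH.
  have := pgroup_fix_mod qa actX.
  rewrite card_lcoset => oFix.
  have [z]: exists z, z \in 'Fix_(X | 'P)(<[a]>).
    apply/set0Pn; apply: contraL isT => /eqP Fix0; move: oFix.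
    rewrite Fix0 cards0 mod0n => /eqP; rewrite -/(dvdn _ _) => q_dv.
    by have := pgroupP (pgroupS sPhiH pH) q q_pr q_dv; rewrite inE (negPf q'p).
  case/setIP=> /lcosetP[f Ff ->{z}] /afixP/(_ a (cycle_id a)) /=; rewrite /aperm => axf.
  have Hf := subsetP sPhiH f Ff.
  rewrite -(mulgK f x) groupM //; first by rewrite mem_gen // inE orbC inE groupM //= axf eqxx.
  by rewrite groupV mem_gen // inE Ff.
Qed.

(** * Automorphism groups leaving every subgroup of order n invariant *)

Section FixedOrder.

Variables (gT : finGroupType) (Q : {group gT}) (A : {group {perm gT}}) (p n : nat).
Hypotheses (p_pr : prime p) (pQ : p.-group Q) (sAQ : A \subset Aut Q).
Hypotheses (n_gt1 : (1 < n)%N) (nQ : n %| #|Q|) (ltnQ : (n < #|Q|)%N).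
Hypothesis invn : forall M : {group gT}, M \subset Q -> #|M| = n -> Astable A M.

(** Each [x] in a noncyclic [H] lies in a maximal subgroup, which has order n and is therefore
    invariant. *)
Lemma noncyclic_Astable (H : {group gT}) :
  H \subset Q -> #|H| = (n * p)%N -> ~~ cyclic H -> Astable A H.
Proof.
move=> sHQ oH ncycH; have pH := pgroupS sHQ pQ.
apply/AstableP=> a x Aa Hx.
have sxH : <[x]> \subset H by rewrite cycle_subG.
have [defH | [M maxM sxM]] := maximal_exists sxH.
  by rewrite -defH cycle_cyclic in ncycH.
have sMH : M \subset H by have /maxgroupp/proper_sub := maxM.
have oM : #|M| = n.
  apply/eqP; rewrite -(eqn_pmul2r (prime_gt0 p_pr)) -oH -(Lagrange sMH).
  by rewrite (p_maximal_index pH maxM).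
have /AstableP invM := invn (subset_trans sMH sHQ) oM.
by apply: (subsetP sMH); apply: invM; rewrite // -cycle_subG.
Qed.

(** By Cauchy, it suffices that an element [a] of prime order q other than p be trivial, hence that
    it fix every [x] of order p. Such an [x] is placed in subgroups M < H of orders n and np. *)
Lemma scalar_ker_pgroup : odd p -> p.-group (scalar_ker Q A p).
Proof.
move=> odd_p.
have [d def_n] := p_natP (pnat_dvd nQ pQ).
have d_gt0 : (0 < d)%N by case: d def_n n_gt1 => // ->.
have p_n : p %| n by rewrite def_n dvdn_exp.
have npQ : (n * p)%N %| #|Q|.
  have [e oQ] := p_natP pQ.
  rewrite oQ def_n -expnSr dvdn_exp2l //.
  by move: ltnQ; rewrite oQ def_n ltn_exp2l ?prime_gt1.
rewrite -[scalar_ker Q A p]/(gval (scalar_ker_group sAQ p)).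
apply/pgroupP=> q q_pr /(Cauchy q_pr)[a Ka oa]; rewrite inE /=.
apply: contraT => q'p; have /scalar_kerP[Aa aK] := Ka.
suffices a1 : a = 1 by move: (prime_gt1 q_pr); rewrite -oa a1 order1.
have AutA b : b \in A -> b \in Aut Q by move/(subsetP sAQ).
apply: (Aut_p'elt_fix_Ohm1 pQ odd_p (AutA a Aa)).
  by rewrite /p_elt oa pnatE // !inE.
move=> x Qx xp1; have [-> | ntx] := eqVneq x 1; first exact: Aut1E (AutA a Aa).
have ox : #[x] = p by apply: nt_prime_order.
have sxQ : <[x]> \subset Q by rewrite cycle_subG.
have dvx_np : #|<[x]>| %| (n * p)%N by rewrite -orderE ox dvdn_mull.
have [H [sxH sHQ oH]] := pgroup_between pQ sxQ dvx_np npQ.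
have pH := pgroupS sHQ pQ.
have dvx_n : #|<[x]>| %| n by rewrite -orderE ox.
have dvn_H : n %| #|H| by rewrite oH dvdn_mulr.
have [M [sxM sMH oM]] := pgroup_between pH sxH dvx_n dvn_H.
have sMQ := subset_trans sMH sHQ; have invM := invn sMQ oM.
have Hx : x \in H by rewrite -cycle_subG.
have [cycH | ncycH] := boolP (cyclic H); last first.
  (* The maximal subgroups of [H] have order n, so [a] acts trivially on every quotient of [H] by
     one of them, hence modulo the Frattini subgroup. *)
  have invH := noncyclic_Astable sHQ oH ncycH.
  have idx (L : {group gT}) : maximal L H -> [/\ L \subset H, #|H : L| = p & Astable A L].
    move=> maxL; have sLH : L \subset H by have /maxgroupp/proper_sub := maxL.
    have iL := p_maximal_index pH maxL; split=> //.
    apply: invn; first exact: subset_trans sHQ.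
    by apply/eqP; rewrite -(eqn_pmul2r (prime_gt0 p_pr)) -oH -(Lagrange sLH) iL.
  apply: (Aut_p'elt_Phi pH sHQ (AutA a Aa) q_pr q'p oa) => // y Hy.
    apply/bigcapP=> L /orP[/eqP-> | maxL].
      by move/AstableP: invH; apply=> //; apply: (subsetP (Phi_sub H)).
    have [sLH _ /AstableP invL] := idx L maxL.
    by apply: invL => //; apply: (subsetP (Phi_sub_max maxL)).
  apply/bigcapP=> L /orP[/eqP-> | maxL].
    by rewrite groupM ?groupV //; move/AstableP: invH; apply.
  have [sLH iL invL] := idx L maxL.
  by have /factor_kerP[_] := aK H L sLH sHQ iL invH invL; apply.
have cycM := cyclicS sMH cycH.
(* In the cyclic case [<[x]>] is the only subgroup of its order in [M], hence invariant, and itself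
   a section of order p. *)
have invx : Astable A <[x]>.
  apply/AstableP=> b _ Ab /cycleP[i ->].
  rewrite (AutX _ (AutA b Ab)) // groupX //.
  have Mbx : b x \in M by move/AstableP: invM; apply; rewrite // -cycle_subG.
  suffices /eqP eqbx : <[b x]> == <[x]> by move: (cycle_id (b x)); rewrite eqbx.
  rewrite (eq_subG_cyclic cycM) ?cycle_subG //; last by rewrite -cycle_subG.
  apply/eqP; change (#|<[b x]>| = #|<[x]>|).
  have -> : <[b x]> = autm (AutA b Ab) @* <[x]> by rewrite morphim_cycle.
  by rewrite card_injm ?injm_autm.
have inv1 : Astable A [1 gT]%G.
  by apply/AstableP=> b y Ab /set1P->; rewrite (Aut1E (AutA b Ab)) set11.
have /factor_kerP[_ /(_ x (cycle_id x))] :=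
  aK <[x]>%G 1%G (sub1G _) sxQ (etrans (indexg1 _) ox) invx inv1.
by move/set1P/eqP; rewrite -eq_mulVg1 => /eqP.
Qed.

(** The derived subgroup of [A] lies in the normal p-subgroup K, hence in [P], and any subgroup
    containing the derived subgroup is normal. *)
Lemma Sylow_normal (P : {group {perm gT}}) : odd p -> p.-Sylow(A) P -> P <| A.
Proof.
move=> odd_p sylP; apply: sub_der1_normal; last exact: pHall_sub sylP.
apply: subset_trans (der1_sub_scalar_ker sAQ p_pr pQ) _.
apply: (normal_sub_max_pgroup (H := scalar_ker_group sAQ p)).
- exact: Hall_max sylP.
- exact: scalar_ker_pgroup.
- exact: scalar_ker_normal.
Qed.

End FixedOrder.

(** * Chief factors *)

Section Eigenvector.

Import GRing.Theory.
Local Open Scope ring_scope.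

(** With q the order of the field, X^q - X annihilates [f] and is the product of all X - x. Without
    an eigenvalue every f - x would be invertible, and so would their product 0. *)
Lemma finField_eigenvalue (F : finFieldType) n (f : 'M[F]_n.+1) :
  f ^+ #|F| = f -> exists c, eigenvalue f c.
Proof.
move=> fF; apply/existsP; apply: contraT; rewrite negb_exists => /forallP ev0.
have: horner_mx f (\prod_x ('X - x%:P)) = 0.
  by rewrite -finField_genPoly rmorphB rmorphXn /= horner_mx_X fF subrr.
rewrite rmorph_prod /= => prod0.
have: \prod_x (f - x%:M) \in unitmx.
  apply: (big_ind (fun g : 'M_n.+1 => g \in unitmx)) => [|g h Ug Uh|x _].
  - exact: unitmx1.
  - by rewrite unitmx_mul Ug.
  - by move: (ev0 x); rewrite negbK kermx_eq0 row_free_unit.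
have -> : \prod_x (f - x%:M) = 0.
  by rewrite -[RHS]prod0; apply: eq_bigr => x _; rewrite rmorphB /= horner_mx_X horner_mx_C.
by rewrite unitmxE det0 unitr0.
Qed.

(** Over the field of order p, [f] becomes a matrix M with M^p = M, so it has an eigenvector; [k] is
    the residue representing the eigenvalue. *)
Lemma abelem_endo_eigenvector (gT : finGroupType) (p : nat) (E : {group gT})
    (f : gT -> gT) :
  prime p -> p.-abelem E -> E :!=: 1%g -> {in E, forall x, f x \in E} ->
  {in E &, {morph f : x y / (x * y)%g}} -> {in E, iter p.-1 f =1 id} ->
  exists k x, [/\ x \in E, x != 1%g & f x = (x ^+ k)%g].
Proof.
move=> p_pr abelE ntE fE fM fp.
have f1 : f 1%g = 1%g by apply: (mulgI (f 1%g)); rewrite -fM ?group1 // !mulg1.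
have fX x k : x \in E -> f (x ^+ k)%g = (f x ^+ k)%g.
  move=> Ex; elim: k => [|k IHk]; first by rewrite expg0.
  by rewrite !expgS fM ?groupX // IHk.
pose r := abelem_rV abelE ntE; pose e := rVabelem abelE ntE.
have eE u : e u \in E by apply: mem_rVabelem.
pose g u := r (f (e u)).
have glin : linear g.
  move=> c u v; rewrite /g /e rVabelemD rVabelemZ fM ?groupX ?eE // fX ?eE //.
  rewrite /r abelem_rV_M ?groupX ?fE ?eE // abelem_rV_X ?fE ?eE //.
  by rewrite natr_Zp.
pose gL : {linear 'rV(E) -> 'rV(E)} := HB.pack g (GRing.isLinear.Build _ _ _ _ g glin).
pose M : 'M['F_p](E) := lin1_mx gL.
have gM u : u *m M = g u by apply: mul_rV_lin1.
have gX k u : u *m (M ^+ k) = r (iter k f (e u)).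
  elim: k u => [|k IHk] u; first by rewrite mulmx1 /= /r /e rVabelemK.
  rewrite exprSr mulmxA IHk gM /g /e /r abelem_rV_K //.
  by elim: k {IHk} => //= k; apply: fE.
have [|c /eigenvalueP[v evv nzv]] := @finField_eigenvalue 'F_p _ M.
  have -> : M ^+ #|'F_p| = M ^+ p.-1 * M by rewrite -exprSr card_Fp ?prednK ?prime_gt0.
  apply/row_matrixP=> i; rewrite !rowE mulmxA gX fp ?eE //.
  by rewrite /r /e rVabelemK.
exists (c : nat), (e v); split=> //.
  apply: contraNneq nzv => ev1; apply/eqP; apply: (rVabelem_inj abelE ntE).
  by rewrite -/e ev1 /e rVabelem0.
have: e (g v) = e (c *: v) by rewrite -gM evv.
by rewrite /e rVabelemZ /g /r abelem_rV_K ?fE.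
Qed.

End Eigenvector.

(** * Orders of chief factors under a group of automorphisms *)

Section ChiefFactor.

Variables (gT : finGroupType) (Q : {group gT}) (A : {group {perm gT}}) (p : nat).
Hypotheses (p_pr : prime p) (pQ : p.-group Q) (sAQ : A \subset Aut Q).
Implicit Types (H M N V : {group gT}) (a b : {perm gT}).

Let AutA a : a \in A -> a \in Aut Q. Proof. exact: subsetP. Qed.

Lemma Astable_gen (X : {set gT}) : X \subset Q ->
  (forall a x, a \in A -> x \in X -> a x \in <<X>>) -> Astable A <<X>>.
Proof.
move=> sXQ aX; apply/AstableP=> a x Aa Xx.
have: autm (AutA Aa) x \in autm (AutA Aa) @* <<X>>.
  by rewrite mem_morphim // (subsetP _ _ Xx) // gen_subG.
rewrite morphim_gen //; apply/subsetP; rewrite gen_subG.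
by apply/subsetP=> _ /morphimP[y Qy Xy ->]; apply: aX.
Qed.

Lemma Astable_Phi V : V \subset Q -> Astable A V -> Astable A 'Phi(V).
Proof.
move=> sVQ /AstableP stV; apply/AstableP=> a x Aa Fx.
have defV : autm (AutA Aa) @* V = V.
  apply/eqP; rewrite eqEcard card_injm ?injm_autm // leqnn andbT.
  by apply/subsetP=> _ /morphimP[y Qy Vy ->]; apply: stV.
have := injm_Phi (injm_autm (AutA Aa)) sVQ; rewrite defV => <-.
apply: (mem_morphim (autm_morphism (AutA Aa))) => //.
by rewrite (subsetP (subset_trans (Phi_sub V) sVQ)).
Qed.

Section Minimal.

Variables N V : {group gT}.
Hypotheses (sVQ : V \subset Q) (sNV : N \subset V) (nNV : V \subset 'N(N)).
Hypotheses (stV : Astable A V) (stN : Astable A N) (abelVN : p.-abelem (V / N)).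
Hypothesis minV : forall H, N \subset H -> H \subset V -> Astable A H ->
  H :=: N \/ H :=: V.
Hypothesis neqNV : N :!=: V.

Let aV a x : a \in A -> x \in V -> a x \in V. Proof. by move/AstableP: stV; apply. Qed.
Let aN a x : a \in A -> x \in N -> a x \in N. Proof. by move/AstableP: stN; apply. Qed.
Let nN x : x \in V -> x \in 'N(N). Proof. exact: subsetP. Qed.
Let QV x : x \in V -> x \in Q. Proof. exact: subsetP. Qed.

Lemma coset_Aut a x y : a \in A -> x \in V -> y \in V ->
  coset N x = coset N y -> coset N (a x) = coset N (a y).
Proof.
move=> Aa Vx Vy /eqP; rewrite -mem_mulVg_coset ?nN // => Nxy.
apply/eqP; rewrite -mem_mulVg_coset ?nN ?aV // -(AutV (AutA Aa)) ?QV //.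
by rewrite -(AutM (AutA Aa)) ?groupV ?QV // aN.
Qed.

Lemma coset_AutM a x y : a \in A -> x \in V -> y \in V ->
  coset N (a (x * y)) = coset N (a x) * coset N (a y).
Proof.
by move=> Aa Vx Vy; rewrite (AutM (AutA Aa)) ?QV // morphM ?nN ?aV.
Qed.

(** The form in which minimality of V/N is used: when the elements of [V] satisfying [P] make up an
    invariant subgroup properly containing [N], they fill [V]. *)
Lemma Astable_coset_set (P : pred gT) (K : {group gT}) :
    (forall x, x \in N -> P x) -> (exists x, [/\ x \in V, x \notin N & P x]) ->
    K :=: [set x in V | P x] -> Astable A K ->
  {in V, forall x, P x}.
Proof.
move=> PN [x [Vx N'x Px]] defK stK y Vy.
have sNK : N \subset K.
  by apply/subsetP=> z Nz; rewrite defK inE PN ?(subsetP sNV).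
have sKV : K \subset V by apply/subsetP=> z; rewrite defK inE => /andP[].
have [eqKN | eqKV] := minV sNK sKV stK.
  by case/negP: N'x; rewrite -eqKN defK inE Vx.
by move: Vy; rewrite -eqKV defK inE => /andP[].
Qed.

(** The p-group [B] permutes the cosets of [N] in [V], whose number is divisible by p, and fixes [N]
    itself; so it fixes a further coset. *)
Lemma fixed_coset (B : {group {perm gT}}) : p.-group B -> B \subset A ->
  exists x, [/\ x \in V, x \notin N & {in B, forall b : {perm gT}, coset N (b x) = coset N x}].
Proof.
move=> pB sBA; have BA b : b \in B -> b \in A by apply: subsetP.
have aR a x : a \in A -> x \in V -> a @: (N :* x) = N :* a x.
  move=> Aa Vx; apply/eqP; rewrite eqEcard card_imset; last exact: perm_inj.
  rewrite !card_rcoset leqnn andbT; apply/subsetP=> _ /imsetP[y /rcosetP[m Nm ->] ->].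
  have Vm := subsetP sNV m Nm.
  by rewrite (AutM (AutA Aa)) ?QV // mem_rcoset mulgK aN.
have actB : [acts B, on rcosets N V | 'P^*].
  apply/subsetP=> b Bb; have Ab := BA b Bb; rewrite !inE /=.
  apply/subsetP=> _ /rcosetsP[x Vx ->]; rewrite inE.
  by apply/rcosetsP; exists (b x); [apply: aV | apply: aR].
have := pgroup_fix_mod pB actB; set R := 'Fix_(_ | _)(_).
have RN : gval N \in R.
  apply/setIP; split; first by apply/rcosetsP; exists 1; rewrite ?group1 ?rcoset1.
  apply/afixP=> b Bb; have := aR b 1 (BA b Bb) (group1 V).
  by rewrite (Aut1E (AutA (BA b Bb))) rcoset1.
have p_VN : p %| #|rcosets N V|.
  rewrite -[#|rcosets N V|]/(#|V : N|) -card_quotient //.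
  have ntVN : V / N != 1.
    by rewrite -subG1 quotient_sub1 // (contra _ neqNV) // => sVN; rewrite eqEsubset sNV.
  by have [] := pgroup_pdiv (abelem_pgroup abelVN) ntVN.
rewrite (eqP p_VN) => /esym/eqP; rewrite -/(dvdn _ _) => p_R.
have /subsetPn[X RX]: ~~ (R \subset [set gval N]).
  apply: contraL p_R => sRN; have/eqP->: R == [set gval N] by rewrite eqEsubset sRN sub1set.
  by rewrite cards1 dvdn1 neq_ltn prime_gt1 ?orbT.
rewrite inE => neqXN.
case/setIP: RX => /rcosetsP[x Vx defX] /afixP fixX; exists x; split=> //.
  by apply: contra neqXN => Nx; rewrite defX rcoset_id.
move=> b Bb; have eqNx : N :* b x = N :* x.
  by rewrite -aR ?BA //; have := fixX b Bb; rewrite defX.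
have: b x \in N :* x by rewrite -eqNx rcoset_refl.
by case/rcosetP=> m Nm ->; rewrite coset_kerl.
Qed.

Hypothesis pK : p.-group (scalar_ker Q A p).

(** The points of V/N fixed by the normal p-subgroup K form an invariant subgroup, nontrivial by
    [fixed_coset], so minimality makes it all of V/N. *)
Lemma scalar_ker_coset b x : b \in scalar_ker Q A p -> x \in V ->
  coset N (b x) = coset N x.
Proof.
set K := scalar_ker_group sAQ p; rewrite -[scalar_ker Q A p]/(gval K) => Kb Vx.
have nKA : K <| A := scalar_ker_normal sAQ p_pr pQ.
have KA c : c \in K -> c \in A by apply/subsetP/normal_sub.
pose P x := [forall c in K, coset N (c x) == coset N x].
have PP y : reflect {in K, forall c : {perm gT}, coset N (c y) = coset N y} (P y).
  by apply: (iffP forall_inP) => Py c /Py; [move/eqP | move->].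
have gW : group_set [set y in V | P y].
  apply/group_setP; split=> [|y z].
    by rewrite inE group1; apply/PP=> c /KA Ac; rewrite (Aut1E (AutA Ac)).
  case/setIdP=> Vy /PP Py /setIdP[Vz /PP Pz]; rewrite inE groupM //=.
  by apply/PP=> c Kc; rewrite coset_AutM ?KA // Py ?Pz // morphM ?nN.
have stW : Astable A (Group gW).
  apply/AstableP=> c y Ac /setIdP[Vy /PP Py]; rewrite inE aV //=.
  apply/PP=> d Kd; have Kdc : d ^ c^-1 \in K by rewrite memJ_norm ?groupV // (subsetP (normal_norm nKA)).
  have -> : d (c y) = c ((d ^ c^-1) y).
    by rewrite -!permM conjgE invgK -!mulgA mulVg mulg1.
  by apply: coset_Aut => //; [rewrite aV ?KA | rewrite Py].
have PN y : y \in N -> P y.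
  by move=> Ny; apply/PP=> c Kc; rewrite !coset_id ?aN ?KA.
have exW : exists y, [/\ y \in V, y \notin N & P y].
  by have [y [Vy N'y /PP Py]] := fixed_coset pK (normal_sub nKA); exists y.
by have /PP := Astable_coset_set PN exW (erefl (gval (Group gW))) stW Vx; apply.
Qed.

(** As [a ^+ p.-1] lies in K, it acts trivially on V/N, so [a] has an eigenvector there. Since [A]
    is commutative modulo K, the eigenspace is invariant, and by minimality it is all of V/N. *)
Lemma Aut_power_coset a : a \in A ->
  exists k, {in V, forall x, coset N (a x) = coset N x ^+ k}.
Proof.
move=> Aa; pose f (c : coset_of N) := coset N (a (repr c)).
have fE x : x \in V -> f (coset N x) = coset N (a x).
  move=> Vx; rewrite /f; set y := repr _.
  have eqyx : coset N y = coset N x by apply: coset_reprK.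
  suffices Vy : y \in V by apply: coset_Aut.
  have Ny : y \in 'N(N) by apply: repr_coset_norm.
  have Nxy : x^-1 * y \in N by rewrite mem_mulVg_coset ?eqyx ?(nN Vx).
  by rewrite -(mulKVg x y) groupM // (subsetP sNV).
have iterf k x : x \in V -> iter k f (coset N x) = coset N ((a ^+ k) x).
  elim: k x => [|k IHk] x Vx; first by rewrite perm1.
  by rewrite iterS IHk // fE ?aV ?groupX // expgSr permM.
have cVN : abelian (V / N) by apply: abelem_abelian abelVN.
have ntVN : V / N != 1.
  by rewrite -subG1 quotient_sub1 // (contra _ neqNV) // => sVN; rewrite eqEsubset sNV.
have fVN : {in V / N, forall c, f c \in V / N}.
  by move=> _ /morphimP[x _ Vx ->]; rewrite fE // mem_quotient ?aV.
have fM : {in V / N &, {morph f : c d / c * d}}.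
  move=> _ _ /morphimP[x _ Vx ->] /morphimP[y _ Vy ->].
  by rewrite /= !fE // -morphM ?nN // fE ?groupM // coset_AutM.
have fp : {in V / N, iter p.-1 f =1 id}.
  move=> _ /morphimP[x _ Vx ->]; rewrite /= iterf // scalar_ker_coset //.
  exact: expg_predn_scalar_ker.
have [k [_ [/morphimP[x Nx Vx ->] ntx fx]]] :=
  abelem_endo_eigenvector p_pr abelVN ntVN fVN fM fp.
rewrite /= in ntx fx.
exists k; pose P x := coset N (a x) == coset N x ^+ k.
have gU : group_set [set y in V | P y].
  apply/group_setP; split=> [|y z].
    by rewrite inE group1 /P (Aut1E (AutA Aa)) morph1 expg1n /=.
  case/setIdP=> Vy /eqP Py /setIdP[Vz /eqP Pz]; rewrite inE groupM //=.
  apply/eqP; rewrite coset_AutM // Py Pz morphM ?nN // expgMn //.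
  by apply: (centsP cVN); rewrite mem_quotient.
have stU : Astable A (Group gU).
  apply/AstableP=> c y Ac /setIdP[Vy /eqP Py]; rewrite inE aV //=.
  have Vyk : y ^+ k \in V by rewrite groupX.
  (* The commutator is chosen so that applying [c] and then [a] amounts to applying [d], [a], [c] in
     this order. *)
  pose d := [~ c^-1, a^-1].
  have Kd : d \in scalar_ker Q A p.
    by rewrite (subsetP (der1_sub_scalar_ker sAQ p_pr pQ)) // mem_commg ?groupV.
  have Ad : d \in A by rewrite groupR ?groupV.
  have -> : P (c y) = (coset N (c (a (d y))) == coset N (c y) ^+ k).
    rewrite /P -!permM; congr (coset N (fun_of_perm _ y) == _).
    by rewrite /d commgEl conjgE !invgK !mulgA !mulgKV.
  apply/eqP; rewrite (@coset_Aut c _ (y ^+ k)) ?aV //; last first.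
    rewrite morphX ?nN // -Py; apply: coset_Aut; rewrite ?aV //.
    exact: scalar_ker_coset.
  by rewrite (AutX _ (AutA Ac)) ?QV // morphX ?nN ?aV.
have PN y : y \in N -> P y.
  by move=> Ny; rewrite /P !coset_id ?aN // expg1n.
have exU : exists y, [/\ y \in V, y \notin N & P y].
  exists x; split=> //; first by apply: contra ntx => /coset_id ->.
  by rewrite /P -fE // fx.
by move=> y Vy; apply/eqP; apply: (Astable_coset_set PN exU (erefl (gval (Group gU)))).
Qed.

(** All of [A] acts on V/N by power maps, so preimages of cyclic subgroups are invariant; by
    minimality V/N is cyclic, besides being elementary abelian. *)
Lemma index_minimal : #|V : N| = p.
Proof.
have /subsetPn[x Vx N'x] : ~~ (V \subset N).
  by apply: contra neqNV => sVN; rewrite eqEsubset sNV.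
pose P y := coset N y \in <[coset N x]>.
have gL : group_set [set y in V | P y].
  apply/group_setP; split=> [|y z]; first by rewrite inE group1 /P morph1 group1.
  case/setIdP=> Vy Py /setIdP[Vz Pz]; rewrite inE groupM //=.
  by rewrite /P morphM ?nN //= groupM.
have stL : Astable A (Group gL).
  apply/AstableP=> c y Ac /setIdP[Vy Py]; rewrite inE aV //=.
  by have [k ck] := Aut_power_coset Ac; rewrite /P ck // groupX.
have PN y : y \in N -> P y by move=> Ny; rewrite /P coset_id.
have exL : exists y, [/\ y \in V, y \notin N & P y].
  by exists x; split; rewrite // /P cycle_id.
have PV := Astable_coset_set PN exL (erefl (gval (Group gL))) stL.
have defVN : V / N = <[coset N x]>.
  apply/eqP; rewrite eqEsubset cycle_subG mem_quotient // andbT.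
  by apply/subsetP=> _ /morphimP[y _ Vy ->]; apply: PV.
rewrite -card_quotient // defVN -orderE; apply: (abelem_order_p abelVN).
  exact: mem_quotient.
by apply: contra N'x => /eqP/coset_idr; apply; apply: nN.
Qed.

End Minimal.

(** The witness is maximal among the proper invariant subgroups of [V]. It contains the Frattini
    subgroup, so its quotient is elementary abelian and the minimal case applies. *)
Lemma Astable_index_p V : p.-group (scalar_ker Q A p) ->
    V \subset Q -> V :!=: 1 -> Astable A V ->
  exists M : {group gT}, [/\ M \subset V, #|V : M| = p & Astable A M].
Proof.
move=> pK sVQ ntV stV; have pV := pgroupS sVQ pQ.
pose propS M := (gval M \proper V) && Astable A M.
have st1 : Astable A 1.
  by apply/AstableP=> a _ Aa /set1P->; rewrite (Aut1E (AutA Aa)) set11.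
have [|N /maxgroupP[/andP[prNV stN] maxN]] := @ex_maxgroup _ propS.
  by exists 1%G; rewrite /propS proper1G ntV.
have sNV := proper_sub prNV.
have minV H : N \subset H -> H \subset V -> Astable A H -> H :=: N \/ H :=: V.
  move=> sNH sHV stH; have [eqHV | neqHV] := eqVneq (H : {set gT}) V; first by right.
  by left; apply: maxN; rewrite // /propS properEneq neqHV sHV.
(* Otherwise, by maximality, [N] and the non-generators in ['Phi(V)] would generate [V], and then
   [N] alone would. *)
have sPhiN : 'Phi(V) \subset N.
  have sNPV : N <*> 'Phi(V) \subset V by rewrite join_subG sNV Phi_sub.
  have stL : Astable A (N <*> 'Phi(V)).
    apply: Astable_gen => [|a x Aa]; first exact: subset_trans (subset_gen _) (subset_trans sNPV sVQ).
    move/AstableP: stN => aN; have /AstableP aP := Astable_Phi sVQ stV.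
    case/setUP=> Zx; rewrite mem_gen // inE; first by rewrite aN.
    by rewrite aP ?orbT.
  have [<-|defV] := minV (N <*> 'Phi(V))%G (joing_subl _ _) sNPV stL.
    exact: joing_subr.
  by case/negP: (proper_subn prNV); rewrite -(genGid N) (@Phi_nongen _ V N) // joingC.
have nsNV : N <| V.
  apply: sub_der1_normal sNV; apply: subset_trans sPhiN.
  by rewrite (Phi_joing pV) joing_subl.
have nNV := normal_norm nsNV.
have abelVN : p.-abelem (V / N).
  rewrite -trivg_Phi ?quotient_pgroup // -(quotient_Phi pV nNV) -subG1.
  by rewrite quotient_sub1 // (subset_trans (Phi_sub V)).
have neqNV : N :!=: V by apply: contraTneq prNV => ->; rewrite properxx.
by exists N; split=> //; apply: (index_minimal sVQ sNV).
Qed.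

End ChiefFactor.

(** * Fusion systems *)

Section FusionBasics.

Variables (gT : finGroupType) (S : {group gT}) (F : fusion_system S).
Implicit Types (P Q R H : {group gT}) (f : gT -> gT) (a : {perm gT}).

Lemma fhom_incl P Q : P \subset Q -> Q \subset S -> fhom F P Q id.
Proof.
move=> sPQ sQS; apply: (fhom_ext (f := conjg^~ 1)) => [x _|]; first by rewrite conjg1.
by apply: fhom_conj; rewrite ?group1 ?conjsg1 // (subset_trans sPQ).
Qed.

Lemma fhom_res P R Q f : R \subset P -> fhom F P Q f -> fhom F R Q f.
Proof.
by move=> sRP Ff; have [sPS _] := fhom_obj Ff; apply: fhom_comp (fhom_incl sRP sPS) Ff.
Qed.

Lemma fhom_widen P Q R f : Q \subset R -> R \subset S -> fhom F P Q f -> fhom F P R f.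
Proof. by move=> sQR sRS Ff; apply: fhom_comp Ff (fhom_incl sQR sRS). Qed.

Lemma fhom_image P Q f : fhom F P Q f ->
  exists R, [/\ f @: P = R, R \subset Q & fiso F P R f].
Proof.
move=> Ff; have [R [eqR [FR invf]]] := fhom_factor Ff.
exists R; split=> //; first by rewrite -eqR; have [] := fhom_inj Ff.
Qed.

Lemma fiso_image P Q f : fiso F P Q f -> f @: P = Q.
Proof.
case=> Ff [g [Fg fK gK]]; apply/eqP; rewrite eqEsubset.
have [_ _ ->] := fhom_inj Ff; apply/subsetP=> y Qy.
have [_ _ /subsetP sgP] := fhom_inj Fg.
by apply/imsetP; exists (g y); rewrite ?gK // sgP ?imset_f.
Qed.

Lemma fhom_fix P Q f : fhom F P Q f -> f @: P = P -> fhom F P P f.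
Proof.
move=> Ff fP; have [R [eqR _ [FR _]]] := fhom_image Ff.
by have eqRP : R = P by [apply: val_inj; rewrite /= -eqR fP]; rewrite eqRP in FR.
Qed.

Lemma fhom_Aut P Q f : fhom F P Q f -> f @: P = P ->
  exists2 a, a \in Aut_fusion F P & {in P, f =1 a}.
Proof.
move=> Ff fP; have FP := fhom_fix Ff fP; have [fM injf _] := fhom_inj FP.
pose h := morphm_morphism fM.
have injh : 'injm h by apply/injmP.
have hP : h @* P = P by rewrite morphimEdom.
exists (aut injh hP); last by move=> x Px; rewrite autE.
by rewrite inE Aut_aut; apply: fhom_ext FP => x Px; rewrite autE.
Qed.

(** The extension is a permutation in Aut_F(S), so that extensions can be composed and inverted as
    group elements. *)
Definition extendible P f : Prop :=
  exists2 a, a \in Aut_fusion F S & {in P, f =1 a}.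

Lemma Aut_fusion_res P H a : P \subset S -> H \subset P -> weakly_closed F H ->
  a \in Aut_fusion F P -> {in H, forall x, a x \in H}.
Proof.
move=> sPS sHP [_ wcH] /setIdP[_ Fa] x Hx.
have FaH : fhom F H S a := fhom_res sHP (fhom_widen sPS (subxx S) Fa).
by rewrite -(wcH _ FaH) imset_f.
Qed.

End FusionBasics.

(** * Transvections *)

Section Transvections.

Variables (gT : finGroupType) (Q : {group gT}).
Hypothesis cQQ : abelian Q.
Implicit Types (s t : {perm gT}) (x y : gT).

Lemma Aut_commute s t : s \in Aut Q -> t \in Aut Q ->
  {in Q, forall x, s (t x) = t (s x)} -> commute s t.
Proof.
move=> As At st; apply: (@eq_Aut _ Q); rewrite ?groupM // => x Qx.
by rewrite !permM st.
Qed.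

(** In additive notation the hypotheses say (s-1)(t-1) = 0 = (t-1)(s-1), so both products of s and t
    equal s + t - 1. *)
Lemma commute_of_fixed_displacement s t : s \in Aut Q -> t \in Aut Q ->
  {in Q, forall x, s (x^-1 * t x) = x^-1 * t x} ->
  {in Q, forall x, t (x^-1 * s x) = x^-1 * s x} ->
  commute s t.
Proof.
move=> As At st ts; apply: Aut_commute => // x Qx.
have [Qsx Qtx] := (Aut_closed As Qx, Aut_closed At Qx).
have Qst : x^-1 * t x \in Q by rewrite groupM ?groupV.
have Qts : x^-1 * s x \in Q by rewrite groupM ?groupV.
have -> : s (t x) = s x * (x^-1 * t x).
  by rewrite -{1}(mulKVg x (t x)) (AutM As) // st.
have -> : t (s x) = t x * (x^-1 * s x).
  by rewrite -{1}(mulKVg x (s x)) (AutM At) // ts.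
by rewrite (centsP cQQ (s x)) // (centsP cQQ x^-1) ?groupV // mulgA.
Qed.

(* On the span of [x] and [y], [t] and [s] are opposite elementary matrices of
   SL_2, and [t * s * t] is the Weyl element, whose square is -1. *)
Lemma opposite_transvections t s x y :
    t \in Aut Q -> s \in Aut Q -> x \in Q -> y \in Q ->
    {in Q, forall q, exists i, t q = q * x ^+ i} ->
    {in Q, forall q, exists j, s q = q * y ^+ j} ->
    t x = x -> s y = y -> t y = y * x -> s x = x * y^-1 ->
  let z := (t * s * t) ^+ 2 in commute t z /\ z y = y^-1.
Proof.
move=> At As Qx Qy tQ sQ tx sy ty sx z.
have cQ u v : u \in Q -> v \in Q -> commute u v by move=> Qu Qv; apply: (centsP cQQ).
pose w := t * s * t; have Aw : w \in Aut Q by rewrite !groupM.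
have Az : z \in Aut Q by rewrite groupX.
have wx : w x = y^-1.
  rewrite !permM tx sx (AutM At) ?groupV // (AutV At) // tx ty invMg mulgA mulgV.
  by rewrite mul1g.
have wy : w y = x.
  rewrite !permM ty (AutM As) // sy sx (cQ x) ?groupV // mulKVg //.
have zx : z x = x^-1 by rewrite /z expgS expg1 permM wx (AutV Aw) // wy.
have zy : z y = y^-1 by rewrite /z expgS expg1 permM wy wx.
split=> //; apply: Aut_commute => // q Qq.
have [[i tq] [j sq]] := (tQ q Qq, sQ q Qq).
(* [r] is the part of [q] fixed by both [t] and [s], hence by [z]; commutation need only be checked
   on [r], [x] and [y]. *)
pose r := q * y ^- i * x ^+ j.
have Qxi k : x ^+ k \in Q by rewrite groupX.
have Qyi k : y ^+ k \in Q by rewrite groupX.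
have Qr : r \in Q by rewrite !groupM ?groupV.
have tr : t r = r.
  rewrite /r !(AutM At) ?groupM ?groupV // (AutV At) // !(AutX _ At) // tq tx ty.
  rewrite expgMn; last exact: cQ.
  by rewrite invMg !mulgA mulgK.
have sr : s r = r.
  rewrite /r !(AutM As) ?groupM ?groupV // (AutV As) // !(AutX _ As) // sq sy sx.
  rewrite (cQ x) ?groupV // expgMn; last by apply: cQ; rewrite ?groupV.
  rewrite -(mulgA q) (cQ (y ^+ j)) ?groupV // !mulgA expgVn mulgK //.
have zr : z r = r by rewrite /z expgS expg1 !permM tr sr tr tr sr tr.
have -> : q = r * (x ^- j * y ^+ i) by rewrite /r mulgA mulgK mulgKV.
have tz u v : u \in Q -> v \in Q -> t (z u) = z (t u) -> t (z v) = z (t v) ->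
    t (z (u * v)) = z (t (u * v)).
  by move=> Qu Qv tzu tzv; rewrite !(AutM Az, AutM At) ?Aut_closed // tzu tzv.
have tzX u k : u \in Q -> t (z u) = z (t u) -> t (z (u ^+ k)) = z (t (u ^+ k)).
  by move=> Qu tzu; rewrite !(AutX _ Az, AutX _ At) ?Aut_closed // tzu.
have tzV u : u \in Q -> t (z u) = z (t u) -> t (z u^-1) = z (t u^-1).
  by move=> Qu tzu; rewrite !(AutV Az, AutV At) ?Aut_closed // tzu.
have tzx : t (z x) = z (t x) by rewrite zx (AutV At) // tx.
have tzy : t (z y) = z (t y).
  by rewrite zy (AutV At) // ty (AutM Az) // zx zy -invMg (cQ x).
have tzr : t (z r) = z (t r) by rewrite zr tr.
have Qu : x ^- j * y ^+ i \in Q by rewrite groupM ?groupV.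
apply: (tz) => //; apply: (tz); rewrite ?groupV // ?tzX //.
by apply: tzV; rewrite ?tzX.
Qed.

End Transvections.

Section Transvection.

Variables (gT : finGroupType) (Q : {group gT}) (p : nat).
Implicit Types (t s a : {perm gT}).

(* In additive notation: [t - 1] has cyclic image, of order dividing p, and
   [(t - 1)^2 = 0]. *)
Definition transvection t := [/\ t \in Aut Q,
  {in Q, forall x, t (x^-1 * t x) = x^-1 * t x},
  {in Q, forall x, (x^-1 * t x) ^+ p = 1} &
  {in Q &, forall x y, t x != x -> exists i, y^-1 * t y = (x^-1 * t x) ^+ i}].

Lemma transvectionJ t a : a \in Aut Q -> transvection t -> transvection (t ^ a).
Proof.
move=> Aa [At tt tp tQ].
have Ata : t ^ a \in Aut Q by rewrite groupJ.
have QaV x : x \in Q -> exists2 y, y \in Q & x = a y.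
  move=> Qx; exists (a^-1 x); last by rewrite permKV.
  by apply: Aut_closed Qx; rewrite groupV.
have dJ y : y \in Q -> (a y)^-1 * (t ^ a) (a y) = a (y^-1 * t y).
  move=> Qy; have Qty := Aut_closed At Qy.
  by rewrite permJ (AutM Aa) ?groupV // (AutV Aa).
split=> // [_ /QaV[y Qy ->] | _ /QaV[y Qy ->] | _ _ /QaV[x Qx ->] /QaV[y Qy ->]].
- by rewrite dJ // permJ tt.
- have Qd : y^-1 * t y \in Q by rewrite groupM ?groupV ?(Aut_closed At).
  by rewrite dJ // -(AutX _ Aa Qd) tp // (Aut1E Aa).
move=> ntx; have [|i def_i] := tQ x y Qx Qy.
  by rewrite -(inj_eq (@perm_inj _ a)) -permJ.
have Qd : x^-1 * t x \in Q by rewrite groupM ?groupV ?(Aut_closed At).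
by exists i; rewrite !dJ // def_i (AutX _ Aa Qd).
Qed.

Hypothesis cQQ : abelian Q.

(** Additively, t^s - 1 is s(t-1)s^-1, which reduces to (t-1)s^-1 under the first alternative and to
    s(t-1) under the second. As (t-1)^2 = 0, its products with t-1 in both orders vanish. *)
Lemma commute_transvectionJ t s : transvection t -> s \in Aut Q ->
    {in Q, forall x, s (x^-1 * t x) = x^-1 * t x} \/
    {in Q, forall x, t (x^-1 * s x) = x^-1 * s x} ->
  commute t (t ^ s).
Proof.
case=> At tt _ _ As stts.
have Ats : t ^ s \in Aut Q by rewrite groupJ.
have QsV x : x \in Q -> exists2 y, y \in Q & x = s y.
  move=> Qx; exists (s^-1 x); last by rewrite permKV.
  by apply: Aut_closed Qx; rewrite groupV.
have Qd a x : a \in Aut Q -> x \in Q -> x^-1 * a x \in Q.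
  by move=> Aa Qx; rewrite groupM ?groupV ?Aut_closed.
have dJ y : y \in Q -> (s y)^-1 * (t ^ s) (s y) = s (y^-1 * t y).
  move=> Qy; have Qty := Aut_closed At Qy.
  by rewrite permJ (AutM As) ?groupV // (AutV As).
apply: (commute_of_fixed_displacement cQQ) => // [_ /QsV[y Qy ->] | x Qx].
  rewrite dJ //; set d := _ * _; have Qdy : d \in Q by apply: Qd.
  case: stts => [st | ts]; first by rewrite st // tt.
  by rewrite -(mulKVg d (s d)) (AutM At) ?ts ?tt ?Qd.
set d := _ * _; have Qdx : d \in Q by apply: Qd.
have [y Qy def_d] := QsV d Qdx; rewrite def_d permJ; congr (s _).
case: stts => [st | ts].
  have -> : y = d by apply: (@perm_inj _ s); rewrite st.
  exact: tt.
have -> : y = d * (y^-1 * s y)^-1 by rewrite def_d invMg invgK mulKVg.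
by rewrite (AutM At) ?groupV ?Qd // (AutV At) ?Qd // ts // tt.
Qed.

(* Two transvections whose axes avoid each other's centre generate a copy of
   SL_2(p), which contains the involution [z]. *)
Lemma opposite_transvections_involution t s :
    prime p -> transvection t -> transvection s ->
    ~~ [forall x in Q, s (x^-1 * t x) == x^-1 * t x] ->
    ~~ [forall x in Q, t (x^-1 * s x) == x^-1 * s x] ->
  exists (z : {perm gT}) (y : gT), [/\ z \in <<[set t; s]>>, commute t z,
    y \in Q, y ^+ p = 1 & t y != y /\ z y = y^-1].
Proof.
move=> p_pr [At tt tp tQ] [As ss sp sQ] /forall_inPn[q1 Qq1 sq1] /forall_inPn[q2 Qq2].
have Qd a x : a \in Aut Q -> x \in Q -> x^-1 * a x \in Q.
  by move=> Aa Qx; rewrite groupM ?groupV ?Aut_closed.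
set y := q2^-1 * s q2; have Qy : y \in Q by apply: Qd.
have sy : s y = y by apply: ss.
have yp : y ^+ p = 1 by apply: sp.
move=> ty; pose x := y^-1 * t y; have Qx : x \in Q by apply: Qd.
have tyx : t y = y * x by rewrite mulKVg.
have tx : t x = x by apply: tt.
have tX q : q \in Q -> exists i, t q = q * x ^+ i.
  by move=> Qq; have [i def_i] := tQ y q Qy Qq ty; exists i; rewrite -def_i mulKVg.
have sq2 : s q2 != q2.
  by apply: contra ty => /eqP sq2; rewrite /y sq2 mulVg (Aut1E At).
have sX q : q \in Q -> exists j, s q = q * y ^+ j.
  by move=> Qq; have [i def_i] := sQ q2 q Qq2 Qq sq2; exists i; rewrite -def_i mulKVg.
have [b sx] := sX x Qx.
have ntyb : y ^+ b != 1.
  apply: contra sq1 => /eqP yb; have [i ->] := tX q1 Qq1.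
  by rewrite mulKg (AutX _ As) // sx yb mulg1.
have nty : y != 1 by apply: contra ntyb => /eqP->; rewrite expg1n.
have oy : #[y] = p by apply: nt_prime_order.
have co_b : coprime #[y] b.
  by rewrite oy prime_coprime // -oy order_dvdn.
(* [b] is prime to p, so some power [u] of [s] satisfies [u x = x * y^-1], the normalization needed
   for the Weyl element. *)
have: y^-1 \in <[y ^+ b]>.
  by have:= co_b; rewrite -generator_coprime => /eqP <-; rewrite groupV cycle_id.
case/cycleP=> k yk; pose u := s ^+ k; have Au : u \in Aut Q by rewrite groupX.
have ux : u x = x * y^-1.
  by rewrite yk; apply: (Aut_iter_fixed k As); rewrite ?groupX // (AutX _ As) // sy.
have uy : u y = y.
  by rewrite (Aut_iter_fixed (y := 1) k As) ?group1 ?mulg1 ?(Aut1E As) // expg1n mulg1.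
have uX q : q \in Q -> exists j, u q = q * y ^+ j.
  move=> Qq; have [j sq] := sX q Qq; exists (j * k)%N; rewrite expgM.
  by apply: (Aut_iter_fixed k As); rewrite ?groupX // (AutX _ As) // sy.
have [tz zy] := opposite_transvections cQQ At Au Qx Qy tX uX tx uy tyx ux.
exists ((t * u * t) ^+ 2), y; split=> //.
by rewrite groupX // !groupM ?groupX // mem_gen // !inE eqxx ?orbT.
Qed.

End Transvection.

(** * Extending automorphisms of a self-centralizing subgroup of order n *)

Section CentricStep.

Variables (gT : finGroupType) (S : {group gT}) (F : fusion_system S) (p n : nat).
Hypotheses (p_pr : prime p) (odd_p : odd p) (pS : p.-group S).
Hypotheses (nS : n %| #|S|) (ltnS : (n < #|S|)%N).
Hypothesis hypn : forall H : {group gT}, H \subset S -> #|H| = n ->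
  abelian H /\ weakly_closed F H.

Lemma normal_order_n (H : {group gT}) : H \subset S -> #|H| = n -> S \subset 'N(H).
Proof.
move=> sHS oH; have [_ [_ wcH]] := hypn sHS oH.
apply/subsetP=> x Sx; have defH : H :^ x = H.
  by apply: wcH; apply: fhom_conj => //; rewrite conj_subG.
by rewrite inE defH.
Qed.

Variable Q : {group gT}.
Hypotheses (sQS : Q \subset S) (oQ : #|Q| = n) (cSQ : 'C_S(Q) \subset Q).

Let cQQ : abelian Q. Proof. by have [] := hypn sQS oQ. Qed.
Let nQS : S \subset 'N(Q). Proof. exact: normal_order_n. Qed.

Section Overgroup.

Variable T : {group gT}.
Hypotheses (sQT : Q \subset T) (sTS : T \subset S) (oT : #|T| = (n * p)%N).

Let n_gt0 : (0 < n)%N. Proof. by rewrite -oQ cardG_gt0. Qed.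
Let iQ : #|T : Q| = p.
Proof. by apply/eqP; rewrite -(eqn_pmul2l n_gt0) -oT -{1}oQ Lagrange. Qed.

(** A maximal subgroup [R] of [T] containing [g] has order n, so it is abelian and [R :&: Q]
    centralizes [g]. This intersection has index p in [Q], which [g] does not centralize, so it is
    the full centralizer. *)
Lemma centric_overgroup g : g \in T -> g \notin Q ->
  exists R : {group gT}, [/\ R \subset S, #|R| = n, g \in R,
    R :&: Q = 'C_Q[g] & maximal 'C_Q[g] Q].
Proof.
move=> Tg Q'g; have pT := pgroupS sTS pS; have Sg := subsetP sTS g Tg.
have sgT : <[g]> \subset T by rewrite cycle_subG.
have Q'C : ~~ (Q \subset 'C[g]).
  apply: contra Q'g => cQg; apply: (subsetP cSQ); rewrite inE Sg.
  by rewrite -sub_cent1.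
have [defT | [R maxR sgR]] := maximal_exists sgT.
  case/negP: Q'C; apply: subset_trans sQT _; rewrite -defT -cent_cycle.
  exact: cycle_abelian.
have sRT : R \subset T by have /maxgroupp/proper_sub := maxR.
have sRS := subset_trans sRT sTS.
have oR : #|R| = n.
  apply/eqP; rewrite -(eqn_pmul2r (prime_gt0 p_pr)) -oT -(Lagrange sRT).
  by rewrite (p_maximal_index pT maxR).
have Rg : g \in R by rewrite -cycle_subG.
have [cRR _] := hypn sRS oR.
have maxQ : maximal Q T by apply: p_index_maximal; rewrite ?iQ.
have defT : Q * R = T.
  apply: (mulg_normal_maximal (p_maximal_normal pT maxQ) maxQ sRT).
  by apply: contra Q'g => /subsetP; apply.
have iRQ : #|Q : R :&: Q| = p.
  have:= mul_cardG Q R; rewrite defT oQ oR oT => /eqP.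
  rewrite -mulnA eqn_pmul2l // => /eqP def_n; rewrite setIC.
  have n0 : (0 < #|Q :&: R|)%N by apply: cardG_gt0.
  by apply/eqP; rewrite -(eqn_pmul2l n0) Lagrange ?subsetIl // oQ def_n mulnC.
have maxRQ : maximal (R :&: Q) Q.
  by apply: p_index_maximal; rewrite ?subsetIr ?iRQ.
have sRQC : R :&: Q \subset 'C_Q[g].
  rewrite subsetI subsetIr /=; apply: subset_trans (subsetIl _ _) _.
  by rewrite -cent_cycle (subset_trans cRR) // centS.
suffices defC : R :&: Q = 'C_Q[g] by exists R; rewrite -defC.
have prC : 'C_Q[g] \proper Q by rewrite properE subsetIl subsetI subxx.
have /maxgroupP[_ maxP] := maxRQ.
by rewrite (maxP 'C_Q[g]%G prC sRQC).
Qed.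

(** The axis is ['C_Q[g]]; its index p bounds the order of displacements and makes their group
    cyclic. Displacements lie in the axis because [Q] normalizes [R] and [g] normalizes [Q]. *)
Lemma conj_aut_transvection g : g \in T -> g \notin Q -> transvection Q p (conj_aut Q g).
Proof.
move=> Tg Q'g; have [R [sRS oR Rg defC maxC]] := centric_overgroup Tg Q'g.
have Sg := subsetP sTS g Tg; have Ng := subsetP nQS g Sg.
have tE x : x \in Q -> conj_aut Q g x = x ^ g by move=> Qx; rewrite norm_conj_autE.
have QJ x : x \in Q -> x ^ g \in Q by move=> Qx; rewrite memJ_norm.
have CE x : x \in Q -> (x ^ g == x) = (x \in 'C_Q[g]).
  by move=> Qx; rewrite inE Qx /= (sameP eqP conjg_fixP) (sameP commgP cent1P).
have QC x : x \in 'C_Q[g] -> x \in Q by case/setIP.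
have pQ := pgroupS sQS pS.
split=> [|x Qx|x Qx|x y Qx Qy].
- by apply: (subsetP (Aut_conj_aut Q 'N(Q))); rewrite mem_morphim.
- have Qd : x^-1 * x ^ g \in Q by rewrite groupM ?groupV ?QJ.
  rewrite !tE //; apply/eqP; rewrite CE // -defC inE Qd andbT.
  have nRx : x \in 'N(R).
    by apply: (subsetP (normal_order_n sRS oR)); apply: (subsetP sQS).
  have -> : x^-1 * x ^ g = (g^-1) ^ x * g by rewrite /conjg !mulgA.
  by rewrite groupM // memJ_norm // groupV.
- rewrite tE //; have cQ u v : u \in Q -> v \in Q -> commute u v by move=> Qu Qv; apply: (centsP cQQ).
  rewrite expgMn; last by apply: cQ; rewrite ?groupV ?QJ.
  rewrite expgVn -conjXg; apply/eqP; rewrite -eq_mulVg1 eq_sym CE; last exact: groupX.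
  have nC : Q \subset 'N('C_Q[g]) by rewrite sub_abelian_norm ?subsetIl.
  have Nx := subsetP nC x Qx; apply: coset_idr; first by rewrite groupX.
  rewrite morphX //= -(p_maximal_index pQ maxC) -card_quotient //.
  by rewrite expg_cardG // mem_quotient.
rewrite !tE // CE // => C'x.
have nC : 'C_Q[g] <| Q by rewrite -sub_abelian_normal ?subsetIl.
have sxQ : <[x]> \subset Q by rewrite cycle_subG.
have defQ : 'C_Q[g] * <[x]> = Q.
  by apply: mulg_normal_maximal nC maxC sxQ _; rewrite cycle_subG.
have: y \in 'C_Q[g] * <[x]> by rewrite defQ.
case/mulsgP=> c _ Cc /cycleP[i ->] ->; exists i.
have Qc := QC c Cc; have /eqP cg : c ^ g == c by rewrite CE.
rewrite conjMg cg invMg mulgA mulgKV conjXg.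
rewrite (@expgMn _ x^-1 (x ^ g)) ?expgVn //.
by apply: (centsP cQQ); rewrite ?groupV ?QJ.
Qed.

End Overgroup.

Hypothesis autQ : fully_automized p F Q.
(** To be supplied by receptivity and the induction on orders: an element of S inducing [u] lies in
    N_a but outside the abelian group [Q]. *)
Hypothesis extTI : forall (a u : {perm gT}), a \in Aut_fusion F Q ->
  u \in Aut_by S Q -> u != 1 -> u ^ a \in Aut_by S Q -> extendible F Q a.

Let G := Group (group_set_Aut_fusion F sQS).
Let P := Aut_by S Q.

Let sylP : p.-Sylow(G) P. Proof. by have := autQ; rewrite /fully_automized inE. Qed.
Let AutG a : a \in G -> a \in Aut Q. Proof. by case/setIdP. Qed.

(** If [b] extends [a], conjugation by [a] sends the automorphism induced by [g] to the one induced
    by [b g], again an element of S. *)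
Lemma extendible_norm a : a \in G -> extendible F Q a -> a \in 'N(P).
Proof.
move=> Ga [b Sb ab]; have Aa := AutG Ga; have /setIdP[Ab _] := Sb.
rewrite inE; apply/subsetP=> _ /imsetP[_ /morphimP[g Ng Sg ->] ->] /=.
have NSbg : b g \in 'N_S(Q).
  have Sbg : b g \in S by apply: (Aut_closed Ab); case/setIP: Sg.
  by rewrite inE Sbg (subsetP nQS).
have Nbg : b g \in 'N(Q) by case/setIP: NSbg.
suffices -> : conj_aut Q g ^ a = conj_aut Q (b g) by rewrite mem_morphim.
have AutC h : h \in 'N(Q) -> conj_aut Q h \in Aut Q.
  by move=> Nh; apply: (subsetP (Aut_conj_aut Q 'N(Q))); rewrite mem_morphim.
apply: (@eq_Aut _ Q); rewrite ?groupJ ?AutC // => x Qx.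
have Qy : a^-1 x \in Q by apply: (@Aut_closed _ Q); rewrite ?groupV.
rewrite -(permKV a x); move: (a^-1 x) Qy => y Qy.
have Qay := Aut_closed Aa Qy.
rewrite permJ !norm_conj_autE // !ab ?memJ_norm //.
have Sy := subsetP sQS y Qy; have [Sg' _] := setIP Sg.
by rewrite /conjg !(AutM Ab) ?groupM ?groupV // (AutV Ab).
Qed.

Lemma p_elt_normP a : a \in G -> a \in 'N(P) -> p.-elt a -> a \in P.
Proof.
move=> Ga Na pa; have sPG := pHall_sub sylP.
have sPN : P \subset 'N_G(P) by rewrite subsetI sPG normG.
have sylPN : p.-Sylow('N_G(P)) P := pHall_subl sPN (subsetIl _ _) sylP.
have nPN : P <| 'N_G(P) by rewrite /normal sPN subsetIr.
by rewrite (mem_normal_Hall sylPN nPN) // inE Ga.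
Qed.

(** Let s = t^a. If s fixes all displacements of t or conversely, s lies in [P] and [extTI] applies
    to [a]. Otherwise t and s are opposite, and the resulting [z] leads to a contradiction. *)
Lemma centric_extendible a : a \in Aut_fusion F Q -> extendible F Q a.
Proof.
rewrite -[Aut_fusion F Q]/(gval G) => Ga; have Aa := AutG Ga.
have pP : p.-group P := pHall_pgroup sylP; have sPG := pHall_sub sylP.
have [d def_n] := p_natP (pnat_dvd nS pS).
have npS : (n * p)%N %| #|S|.
  have [e oS] := p_natP pS.
  rewrite oS def_n -expnSr dvdn_exp2l //.
  by move: ltnS; rewrite oS def_n ltn_exp2l ?prime_gt1.
have dvQ : #|Q| %| (n * p)%N by rewrite oQ dvdn_mulr.
have [T [sQT sTS oT]] := pgroup_between pS sQS dvQ npS.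
have /subsetPn[g Tg Q'g] : ~~ (T \subset Q).
  have n_gt0 : (0 < n)%N by rewrite -oQ cardG_gt0.
  apply/negP=> /subset_leq_card; rewrite oT oQ.
  by rewrite leqNgt -{1}(muln1 n) ltn_pmul2l // prime_gt1.
have Sg := subsetP sTS g Tg; have Ng := subsetP nQS g Sg.
pose t := conj_aut Q g.
have tE x : x \in Q -> t x = x ^ g by move=> Qx; rewrite /t norm_conj_autE.
have tvt : transvection Q p t by apply: (conj_aut_transvection sQT sTS oT).
have Pt : t \in P by rewrite mem_morphim // inE Sg.
have nt1 : t != 1.
  apply: contra Q'g => /eqP t1; apply: (subsetP cSQ); rewrite inE Sg.
  by apply/centP=> x Qx; apply/commute_sym/commgP/conjg_fixP; rewrite -tE // t1 perm1.
pose s := t ^ a.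
have As : s \in G by rewrite groupJ // (subsetP sPG).
have tvs : transvection Q p s by apply: transvectionJ.
have [At _ _ _] := tvt; have [AsQ _ _ _] := tvs.
have Gt : t \in G := subsetP sPG t Pt.
have pt : p.-elt t := mem_p_elt pP Pt.
have [st | /negP nst] := boolP ([forall x in Q, s (x^-1 * t x) == x^-1 * t x]
                     || [forall x in Q, t (x^-1 * s x) == x^-1 * s x]).
  (* Here [c = t^-1 * t ^ s] centralizes [t], so it extends to S and normalizes
     P; being a p-element it lies in P, and so does [t ^ s]. Then [s] extends
     to S and lies in P for the same reasons. *)
  have cts : commute t (t ^ s).
    apply: (commute_transvectionJ cQQ tvt AsQ).
    by case/orP: st => /forall_inP st; [left | right] => x /st/eqP.
  pose c := t^-1 * t ^ s; have Gts : t ^ s \in G by rewrite groupJ.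
  have Gc : c \in G by rewrite groupM ?groupV.
  have ctc : t ^ c = t.
    by apply/conjg_fixP/commgP/commuteM => //; apply: commuteV.
  have Nc : c \in 'N(P).
    by apply: extendible_norm => //; apply: (extTI (u := t)); rewrite ?ctc.
  have Pc : c \in P.
    apply: p_elt_normP => //; apply: p_eltM; rewrite ?p_eltV ?p_eltJ //.
    exact/commute_sym/commuteV/commute_sym.
  have Pts : t ^ s \in P by rewrite -(mulKVg t (t ^ s)) groupM.
  have Ns : s \in 'N(P).
    by apply: extendible_norm => //; apply: (extTI (u := t)).
  by apply: (extTI (u := t)) => //; apply: p_elt_normP; rewrite // p_eltJ.
have [nst1 nst2] : ~~ [forall x in Q, s (x^-1 * t x) == x^-1 * t x] /\
    ~~ [forall x in Q, t (x^-1 * s x) == x^-1 * s x].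
  by apply/andP; rewrite -negb_or; apply/negP.
have [z [y [tsz ctz Qy yp [tyN zy]]]] :=
  opposite_transvections_involution cQQ p_pr tvt tvs nst1 nst2.
have Gz : z \in G.
  by apply: (subsetP _ z tsz); rewrite gen_subG subUset !sub1set Gt.
have [b Sb zb] : extendible F Q z.
  by apply: (extTI (u := t)); rewrite // (conjg_fixP _) //; apply/commgP.
have [Ab _] := setIdP Sb; have Az := AutG Gz.
have QC x : x \in 'C_Q[g] -> x \in Q by case/setIP.
(* [b] leaves invariant the subgroup [R] of order n through [h], so [h^-1 * b h] lies in [R], which
   meets [Q] in the centralizer of [h]. *)
have bR h : h \in T -> h \notin Q -> h^-1 * b h \in Q -> h^-1 * b h \in 'C_Q[h].
  move=> Th Q'h Qbh; have [R [sRS oR Rh <- _]] := centric_overgroup sQT sTS oT Th Q'h.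
  have [_ wcR] := hypn sRS oR.
  rewrite inE Qbh andbT groupM ?groupV //.
  exact: (Aut_fusion_res (subxx S) sRS wcR Sb).
have Sbg : b g \in S := Aut_closed Ab Sg.
(* As [z] commutes with [t], the elements [g] and [b g] induce the same automorphism of [Q]; so
   [g^-1 * b g] centralizes [Q] and lies in it. *)
have zJ x : x \in Q -> x ^ b g = x ^ g.
  move=> Qx; have Qv : z^-1 x \in Q by apply: (@Aut_closed _ Q); rewrite ?groupV.
  rewrite -(permKV z x); move: (z^-1 x) Qv => v Qv.
  have Qzv := Aut_closed Az Qv; have Sv := subsetP sQS v Qv.
  rewrite -(tE (z v)) // -[t (z v)]permM -ctz permM tE // !zb ?memJ_norm //.
  by rewrite /conjg !(AutM Ab) ?groupM ?groupV // (AutV Ab).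
have Qbg : g^-1 * b g \in Q.
  apply: (subsetP cSQ); rewrite inE groupM ?groupV //=.
  apply/centP=> x Qx; apply/commute_sym/commgP/conjg_fixP.
  have Qxg : x ^ g^-1 \in Q by rewrite memJ_norm ?groupV.
  by rewrite conjgM zJ // conjgKV.
have Cbg := bR g Tg Q'g Qbg.
have Ty := subsetP sQT y Qy; have Q'gy : g * y \notin Q by rewrite groupMr.
have Sy := subsetP sQS y Qy.
(* Since [b] inverts [y], the displacements of [g] and [g * y] differ by the square of [y] or its
   inverse; both centralize [g], hence so does that square. *)
have def_bgy : (g * y)^-1 * b (g * y) = y^-1 * (g^-1 * b g) * y^-1.
  by rewrite (AutM Ab) // -(zb y) // zy invMg !mulgA.
have: (g * y)^-1 * b (g * y) \in 'C_Q[g * y].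
  by apply: bR => //; [apply: groupM | rewrite def_bgy groupM ?groupV // groupM ?groupV].
have -> : 'C_Q[g * y] = 'C_Q[g].
  have cyQ x : x \in Q -> x ^ y = x.
    by move=> Qx; apply/conjg_fixP/commgP; apply: (centsP cQQ).
  have CE h x : (x \in 'C[h]) = (x ^ h == x).
    by rewrite (sameP eqP conjg_fixP) (sameP commgP cent1P).
  apply/setP=> x; rewrite !(in_setI, CE); apply: andb_id2l => Qx.
  by rewrite conjgM cyQ // memJ_norm.
have cQ u v : u \in Q -> v \in Q -> commute u v by move=> Qu Qv; apply: (centsP cQQ).
rewrite def_bgy (cQ y^-1) ?groupV // -mulgA groupMl // -invMg groupV => Cyy.
case/negP: tyN; rewrite tE //; apply/eqP/conjg_fixP/commgP/cent1P.
suffices: y \in 'C_Q[g] by case/setIP.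
(* As p is odd and [y ^+ p = 1], [y] is a power of its square, so [g] centralizes it, against
   [tyN]. *)
have -> : y = (y * y) ^+ (p.+1)./2.
  rewrite -expg2 -expgM mul2n; have -> : ((p.+1)./2.*2 = p.+1)%N.
    by rewrite -[RHS]odd_double_half /= odd_p.
  by rewrite expgS yp mulg1.
by rewrite groupX.
Qed.

End CentricStep.

(** * Extension of morphisms to S *)

Section Extension.

Variables (gT : finGroupType) (S : {group gT}) (F : fusion_system S) (p : nat).
Hypothesis pS : p.-group S.
Implicit Types (P Q R : {group gT}) (f : gT -> gT) (a b : {perm gT}).

Lemma fhom_sub P R Q f : fhom F P R f -> f @: P \subset Q -> Q \subset S -> fhom F P Q f.
Proof.
move=> Ff sfPQ sQS; have [R' [eqR _ [FR _]]] := fhom_image Ff.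
by apply: fhom_widen sQS FR; rewrite -eqR.
Qed.

Lemma Aut_fusion_fiso P a : P \subset S -> a \in Aut_fusion F P -> fiso F P P a.
Proof.
move=> sPS Aa; have /setIdP[_ Fa] := Aa; split=> //; exists (a^-1 : {perm gT}).
have /setIdP[_ FaV] : a^-1 \in Group (group_set_Aut_fusion F sPS) by rewrite groupV.
by split=> // x _; rewrite ?permK ?permKV.
Qed.

Lemma fiso_sym P Q f : fiso F P Q f -> exists2 g, fiso F Q P g & {in P, cancel f g}.
Proof. by case=> Ff [g [Fg fK gK]]; exists g => //; split=> //; exists f. Qed.

Lemma fiso_trans P Q R f g : fiso F P Q f -> fiso F Q R g -> fiso F P R (g \o f).
Proof.
case=> Ff [f' [Ff' fK f'K]] [Fg [g' [Fg' gK g'K]]]; split; first exact: fhom_comp Ff Fg.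
have [_ _ /subsetP sfQ] := fhom_inj Ff; have [_ _ /subsetP sgQ] := fhom_inj Fg'.
exists (f' \o g'); split=> [|x Px|y Ry] /=; first exact: fhom_comp Fg' Ff'.
  by rewrite gK ?fK // sfQ ?imset_f.
by rewrite f'K ?g'K // sgQ ?imset_f.
Qed.

Lemma fiso_card P Q f : fiso F P Q f -> #|Q| = #|P|.
Proof.
move=> isof; rewrite -(fiso_image isof) card_in_imset //.
by have [_ inj _] := fhom_inj isof.1.
Qed.

Section Step.

Variable m : nat.
Hypothesis IH : forall R f, (m < #|R|)%N -> fhom F R S f -> extendible F R f.

(** The element [g] makes N_f strictly larger than [P], so receptivity extends [f] to a subgroup to
    which [IH] applies. *)
Lemma receptive_extendible P Q f g : #|P| = m -> P \subset S -> receptive F Q ->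
    fiso F P Q f -> g \in Nphi S P Q f -> g \notin P -> extendible F P f.
Proof.
move=> oP sPS recQ isof Nfg P'g; have [h Fh hf] := recQ P f isof.
have [Ff _] := isof; have [sfM _ /subsetP sfQ] := fhom_inj Ff.
have sPN : P \subset Nphi_group S P Q f.
  apply/subsetP=> x Px; apply/setIdP; split.
    by rewrite inE (subsetP sPS) // (subsetP (normG P)).
  have Qfx : f x \in Q by rewrite sfQ ?imset_f.
  have Sfx : f x \in S by rewrite (subsetP (fhom_obj Ff).2).
  apply/exists_inP; exists (conj_aut Q (f x)).
    by rewrite mem_morphim ?(in_setI, Sfx) // (subsetP (normG Q)).
  apply/forall_inP=> y Py; have Qfy : f y \in Q by rewrite sfQ ?imset_f.
  rewrite conj_autE // /conjg !(morphicP sfM) ?groupM ?groupV //.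
  by rewrite -[f x^-1]/(morphm sfM x^-1) morphV.
have ltmN : (m < #|Nphi_group S P Q f|)%N.
  rewrite -oP proper_card // properE sPN; apply/subsetPn; exists g => //.
have [b Sb hb] := IH ltmN Fh; exists b => // x Px.
by rewrite -hf // hb // (subsetP sPN).
Qed.

(* Alperin's argument: a Sylow conjugation in Aut_F(Q) makes [f] carry the
   image of N_S(P) into Aut_S(Q), so that [f] extends to N_S(P). *)
Lemma fiso_Aut_fusion P Q f : #|P| = m -> P \proper S ->
    fully_automized p F Q -> receptive F Q -> fiso F P Q f ->
  exists2 b, b \in Aut_fusion F S & {in P, forall x, b x \in Q}.
Proof.
move=> oP prP autQ recQ isof; have sPS := proper_sub prP.
have [Ff [f' [Ff' fK f'K]]] := isof; have [fM injf sfPQ] := fhom_inj Ff.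
have [_ sQS] := fhom_obj Ff.
pose G := Group (group_set_Aut_fusion F sQS).
have sylQ : p.-Sylow(G) (Aut_by S Q) by have := autQ; rewrite /fully_automized inE.
pose h := morphm_morphism fM; have injh : 'injm h by apply/injmP.
have hP : h @* P = Q by rewrite morphimEdom; apply: fiso_image isof.
pose I := Aut_isom injh (subxx P).
have AP g : g \in 'N_S(P) -> conj_aut P g \in Aut P.
  case/setIP=> _ Ng.
  by apply: (subsetP (Aut_conj_aut P 'N(P))); rewrite mem_morphim.
have IE g x : g \in 'N_S(P) -> x \in P -> I (conj_aut P g) (f x) = f (x ^ g).
  move=> Ng Px; have [_ NPg] := setIP Ng.
  by rewrite -[f x]/(h x) (Aut_isomE injh (subxx P) (AP g Ng) Px) norm_conj_autE.
(* Aut_S(P) transported along [f]: a p-subgroup of Aut_F(Q), so a conjugate of it lies in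
   Aut_S(Q). *)
pose B := (Aut_isom_morphism injh (subxx P) @* Aut_by S P)%G.
have sBG : B \subset G.
  apply/subsetP=> _ /morphimP[_ _ /morphimP[g NPg Ng ->] ->] /=; apply/setIdP; split.
    by rewrite -hP; apply: Aut_Aut_isom.
  have [Sg _] := setIP Ng.
  have Fg : fhom F P P (conjg^~ g) by apply: fhom_conj; rewrite ?(normP NPg).
  apply: fhom_ext (fhom_comp Ff' (fhom_comp Fg Ff)) => y Qy /=.
  have Pf'y : f' y \in P by have [_ _ /subsetP] := fhom_inj Ff'; apply; apply: imset_f.
  by rewrite -{2}(f'K y Qy) -/I IE.
have pB : p.-group B by rewrite !morphim_pgroup // (pgroupS (subsetIl _ _)).
have [c Gc sBc] := Sylow_Jsub sylQ sBG pB.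
have isocf : fiso F P Q (c \o f) := fiso_trans isof (Aut_fusion_fiso sQS Gc).
have sNN : 'N_S(P) \subset Nphi S P Q (c \o f).
  apply/subsetP=> g Ng; apply/setIdP; split=> //; have [Sg NPg] := setIP Ng.
  apply/exists_inP; exists (I (conj_aut P g) ^ c).
    apply: (subsetP sBc); rewrite memJ_conjg.
    by apply: (mem_morphim (Aut_isom_morphism injh (subxx P)) (AP g Ng)); rewrite mem_morphim.
  by apply/forall_inP=> x Px; rewrite /= permJ IE.
have /properP[_ [g Ng P'g]] := nilpotent_proper_norm (pgroup_nil pS) prP.
have [b Sb cfb] :=
  receptive_extendible oP sPS recQ isocf (subsetP sNN g Ng) P'g.
(* [b] extends [f] followed by [c], not [f] itself, but it still maps [P] into [Q]. *)
exists b => // x Px; rewrite -cfb //=.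
by have [_ _ /subsetP] := fhom_inj isocf.1; apply; apply/imsetP; exists x.
Qed.

Hypothesis satF : saturated p F.
Hypothesis stepQ : forall Q a, #|Q| = m -> Q \proper S -> fully_automized p F Q ->
  receptive F Q -> a \in Aut_fusion F Q -> extendible F Q a.

(** Elements [b] and [c] of Aut_F(S) carry [P] and its image under [f] to the same [Q]. This turns
    [f] into an element of Aut_F(Q), which [stepQ] extends to [d]. *)
Lemma extendible_step P f : #|P| = m -> P \proper S -> fhom F P S f -> extendible F P f.
Proof.
move=> oP prP Ff; have sPS := proper_sub prP.
have [Q [[e isoe] autQ recQ]] := satF sPS; have [_ sQS] := fhom_obj isoe.1.
have [R [_ sRS isof]] := fhom_image Ff.
have [f' isof' fK] := fiso_sym isof.
have isoRQ := fiso_trans isof' isoe.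
have oQ : #|Q| = m by rewrite (fiso_card isoe).
have oR : #|R| = m by rewrite (fiso_card isof).
have proper_m (H : {group gT}) : H \subset S -> #|H| = m -> H \proper S.
  by move=> sHS oH; rewrite properEcard sHS oH -oP proper_card.
have [b Sb bPQ] := fiso_Aut_fusion oP prP autQ recQ isoe.
have [c Sc cRQ] := fiso_Aut_fusion oR (proper_m R sRS oR) autQ recQ isoRQ.
pose GS := Group (group_set_Aut_fusion F (subxx S)).
have imP : b @: P = Q.
  apply/eqP; rewrite eqEcard card_imset; last exact: perm_inj.
  by rewrite oP oQ leqnn andbT; apply/subsetP=> _ /imsetP[x Px ->]; apply: bPQ.
have imQ : b^-1%g @: Q = P.
  by rewrite -imP -imset_comp -[RHS]imset_id; apply: eq_imset => x /=; rewrite permK.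
have /setIdP[_ FbV] : b^-1 \in GS by rewrite groupV.
have /setIdP[_ Fc] := Sc.
have FbQ : fhom F Q P (b^-1%g : {perm gT}).
  by apply: fhom_sub (fhom_res sQS FbV) _ sPS; rewrite imQ.
have FcR : fhom F R Q c.
  apply: fhom_sub (fhom_res sRS Fc) _ sQS.
  by apply/subsetP=> _ /imsetP[x Rx ->]; apply: cRQ.
have Ftheta := fhom_comp FbQ (fhom_comp isof.1 FcR).
have imtheta : ((c \o f) \o (b^-1%g : {perm gT})) @: Q = Q.
  have [_ inj sQQ] := fhom_inj Ftheta.
  by apply/eqP; rewrite eqEcard sQQ (card_in_imset inj) leqnn.
have [a Aa atheta] := fhom_Aut Ftheta imtheta.
have [d Sd ad] := stepQ oQ (proper_m Q sQS oQ) autQ recQ Aa.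
exists (b * d * c^-1); first by rewrite -[Aut_fusion F S]/(gval GS) !groupM ?groupV.
move=> x Px; rewrite !permM -ad ?bPQ // -atheta ?bPQ //=.
by rewrite !permK.
Qed.

End Step.

(** Downward induction on the order of [P], starting from [P = S], where [f] is already an
    automorphism. *)
Lemma saturated_extendible : saturated p F ->
    (forall m Q a, (forall R f, (m < #|R|)%N -> fhom F R S f -> extendible F R f) ->
      #|Q| = m -> Q \proper S -> fully_automized p F Q ->
      receptive F Q -> a \in Aut_fusion F Q -> extendible F Q a) ->
  forall P f, fhom F P S f -> extendible F P f.
Proof.
move=> satF stepQ P f; have [k] := ubnP (#|S| - #|P|).
elim: k P f => // k IHk P f; rewrite ltnS => le_k Ff.
have [sPS _] := fhom_obj Ff.
have [eqPS | neqPS] := eqVneq (P : {set gT}) S.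
  have defP : P = S by apply: val_inj.
  rewrite defP in Ff *; have imS : f @: S = S.
    have [_ inj sSS] := fhom_inj Ff.
    by apply/eqP; rewrite eqEcard sSS (card_in_imset inj) leqnn.
  exact: fhom_Aut Ff imS.
have prP : P \proper S by rewrite properEneq neqPS.
have IH R g : (#|P| < #|R|)%N -> fhom F R S g -> extendible F R g.
  move=> ltPR Fg; apply: IHk => //; apply: leq_trans le_k.
  have leRS : (#|R| <= #|S|)%N by rewrite subset_leq_card // (fhom_obj Fg).1.
  by apply: ltn_sub2l => //; apply: leq_trans ltPR leRS.
by apply: (extendible_step IH satF) => // Q a; apply: stepQ.
Qed.

End Extension.

(** * The series of strongly closed subgroups *)

Section Main.

Variables (gT : finGroupType) (S : {group gT}) (F : fusion_system S) (p n : nat).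
Hypotheses (p_pr : prime p) (pS : p.-group S).

Let A := Group (group_set_Aut_fusion F (subxx S)).

(** Once all morphisms extend to S, Aut_F(S)-invariant subgroups are strongly closed; the series
    descends from S through invariant subgroups of index p. *)
Lemma supersolvable_of_Astable :
  (forall P f, fhom F P S f -> extendible F P f) ->
  (forall V : {group gT}, V \subset S -> V :!=: 1 -> Astable A V ->
    exists M : {group gT}, [/\ M \subset V, #|V : M| = p & Astable A M]) ->
  supersolvable F.
Proof.
move=> extF stepV.
have clF (V : {group gT}) : V \subset S -> Astable A V -> strongly_closed F V.
  move=> sVS /AstableP stV; split=> // P f sPV /extF[b Sb fb].
  by apply/subsetP=> _ /imsetP[x Px ->]; rewrite fb // stV // (subsetP sPV).
have series k (V : {group gT}) : (#|V| < k)%N -> V \subset S -> Astable A V ->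
  exists m (T : nat -> {group gT}), [/\ T 0%N :=: 1, T m = V,
    forall i, (i <= m)%N -> T i \subset S /\ Astable A (T i)
  & forall i, (i < m)%N -> T i \subset T i.+1 /\ cyclic (T i.+1 / T i)].
  elim: k V => // k IHk V leVk sVS stV.
  have [V1 | ntV] := eqVneq (V : {set gT}) 1.
    by exists 0%N, (fun=> V).
  have [M [sMV iM stM]] := stepV V sVS ntV stV.
  have maxM : maximal M V by apply: p_index_maximal; rewrite ?iM.
  have ltMk : (#|M| < k)%N.
    exact: leq_trans (proper_card (maxgroupp maxM)) leVk.
  have nMV := normal_norm (p_maximal_normal (pgroupS sVS pS) maxM).
  have [m [T [T0 Tm stT facT]]] := IHk M ltMk (subset_trans sMV sVS) stM.
  (* The series for [M] is prolonged by [V] at the index m + 1. *)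
  exists m.+1, (fun i => if (i <= m)%N then T i else V); split=> //=.
  - by rewrite ltnn.
  - by move=> i _; case: ifP => [/stT | _].
  move=> i; rewrite ltnS => le_im; rewrite le_im; case: ltngtP le_im => // [lt_im | ->] _.
    exact: facT.
  by rewrite Tm; split=> //; rewrite prime_cyclic // card_quotient ?iM.
have stS : Astable A S.
  by apply/AstableP=> a x /setIdP[Aa _] Sx; apply: (Aut_closed Aa Sx).
have [m [T [T0 Tm stT facT]]] := series _ S (leqnn _) (subxx S) stS.
by exists m, T; split=> // [|i /stT[]]; [rewrite Tm | apply: clF].
Qed.

Hypotheses (odd_p : odd p) (n_gt1 : (1 < n)%N) (nS : n %| #|S|) (ltnS : (n < #|S|)%N).
Hypothesis hypn : forall H : {group gT}, H \subset S -> #|H| = n ->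
  abelian H /\ weakly_closed F H.

Lemma Aut_fusion_Astable (Q : {group gT}) (sQS : Q \subset S) (H : {group gT}) :
  H \subset Q -> #|H| = n -> Astable (Group (group_set_Aut_fusion F sQS)) H.
Proof.
move=> sHQ oH; have [_ wcH] := hypn (subset_trans sHQ sQS) oH.
by apply/AstableP=> a x Aa; apply: (Aut_fusion_res sQS sHQ wcH Aa).
Qed.

(** By [receptive_extendible], an element of N_a outside [Q] suffices. Such an element is found in
    N_S(Q) if [Q] has order above n, and in C_S(Q) if this is not inside [Q]; what remains is the
    self-centralizing case of order n. *)
Lemma Aut_fusion_extendible m (Q : {group gT}) a :
    (forall (R : {group gT}) f, (m < #|R|)%N -> fhom F R S f -> extendible F R f) ->
    #|Q| = m -> Q \proper S -> fully_automized p F Q -> receptive F Q ->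
  a \in Aut_fusion F Q -> extendible F Q a.
Proof.
move=> IH oQ prQ autQ recQ Aa; have sQS := proper_sub prQ.
have pQ := pgroupS sQS pS; have isoa := Aut_fusion_fiso sQS Aa.
pose G := Group (group_set_Aut_fusion F sQS); have Ga : a \in G by [].
have [AQa _] := setIdP Aa.
have extg g : g \in Nphi S Q Q a -> g \notin Q -> extendible F Q a.
  exact: (receptive_extendible IH).
have [i def_n] := p_natP (pnat_dvd nS pS); have [j def_Q] := p_natP pQ.
have cE g x : g \in 'N_S(Q) -> x \in Q -> conj_aut Q g x = x ^ g.
  by case/setIP=> _ Ng Qx; rewrite norm_conj_autE.
have Nphi_intro (b : {perm gT}) g u : b \in Aut_fusion F Q ->
    g \in 'N_S(Q) -> u = conj_aut Q g -> u ^ b \in Aut_by S Q -> g \in Nphi S Q Q b.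
  move=> Ab Ng -> Pu; apply/setIdP; split=> //; apply/exists_inP; eexists; first exact: Pu.
  by apply/forall_inP=> x Qx; rewrite permJ cE.
have [ltnQ | leQn] := ltnP n #|Q|.
  have sylQ : p.-Sylow(G) (Aut_by S Q) by have := autQ; rewrite /fully_automized inE.
  have nQ : n %| #|Q|.
    rewrite def_Q def_n dvdn_exp2l // ltnW //.
    by move: ltnQ; rewrite def_Q def_n ltn_exp2l ?prime_gt1.
  have sGA : G \subset Aut Q by apply/subsetP=> b /setIdP[].
  (* Aut_S(Q) is normal in Aut_F(Q), so all of N_S(Q) lies in N_a. *)
  have nPG := Sylow_normal p_pr pQ sGA n_gt1 nQ ltnQ
                (Aut_fusion_Astable sQS) odd_p sylQ.
  have /properP[_ [g Ng Q'g]] := nilpotent_proper_norm (pgroup_nil pS) prQ.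
  apply: extg Q'g; apply: (Nphi_intro a g _ Aa Ng (erefl _)).
  rewrite memJ_norm ?(subsetP (normal_norm nPG)) // mem_morphim //.
  by case/setIP: Ng.
have [cSQ | /subsetPn[g CSg Q'g]] := boolP ('C_S(Q) \subset Q); last first.
  have Ng : g \in 'N_S(Q) by apply: subsetP CSg; rewrite setIS ?cent_sub.
  apply: extg Q'g; apply: (Nphi_intro a g 1 Aa Ng); last by rewrite conj1g group1.
  have [Sg Cg] := setIP CSg; apply/esym; apply: (@eq_Aut _ Q); rewrite ?group1 //.
    by apply: (subsetP (Aut_conj_aut Q 'N(Q))); rewrite mem_morphim //; case/setIP: Ng.
  move=> x Qx; rewrite cE // perm1; apply/conjg_fixP/commgP/commute_sym.
  exact: (centP Cg).
have nQ : #|Q| %| n.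
  rewrite def_Q def_n dvdn_exp2l // -(leq_exp2l _ _ (prime_gt1 p_pr)).
  by rewrite -def_Q -def_n.
(* A subgroup [H] of order n containing [Q] is abelian, so it centralizes [Q] and lies in it; hence
   [Q] has order n. *)
have [H [sQH sHS oH]] := pgroup_between pS sQS nQ nS.
have [cHH _] := hypn sHS oH.
have sHQ : H \subset Q.
  by apply: subset_trans cSQ; rewrite subsetI sHS (subset_trans cHH) // centS.
have on : #|Q| = n by rewrite -oH; apply/eqP; rewrite eqn_leq !subset_leq_card.
apply: (centric_extendible p_pr odd_p pS nS ltnS hypn sQS on cSQ autQ _ Aa).
move=> b u Ab /morphimP[g Ng NSg ->] nt1 Pub.
apply: (receptive_extendible IH oQ sQS recQ (Aut_fusion_fiso sQS Ab) (g := g)).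
  exact: (Nphi_intro b g _ Ab NSg (erefl _)).
apply: contra nt1 => Qg; have [cQQ _] := hypn sQS on.
apply/eqP; apply: (@eq_Aut _ Q); rewrite ?group1 //.
  by apply: (subsetP (Aut_conj_aut Q 'N(Q))); rewrite mem_morphim.
move=> x Qx; rewrite cE // perm1; apply/conjg_fixP/commgP.
exact: (centsP cQQ).
Qed.

Lemma supersolvable_of_order_n : saturated p F -> supersolvable F.
Proof.
move=> satF; apply: supersolvable_of_Astable => [|V sVS ntV stV].
  by apply: (saturated_extendible pS satF); apply: Aut_fusion_extendible.
have sAS : A \subset Aut S by apply/subsetP=> b /setIdP[].
apply: (Astable_index_p p_pr pS sAS _ sVS ntV stV).
exact: (scalar_ker_pgroup p_pr pS sAS n_gt1 nS ltnS (Aut_fusion_Astable (subxx S))).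
Qed.

End Main.

Theorem theorem4 (p : nat) (gT : finGroupType) (S : {group gT})
    (F : fusion_system S) (D : {group gT}) :
  prime p -> odd p -> p.-group S -> saturated p F ->
  [1 gT] \proper D -> D \proper S ->
  (forall H : {group gT}, H \subset S -> #|H| = #|D| ->
    abelian H /\ weakly_closed F H) ->
  supersolvable F.
Proof.
move=> p_pr odd_p pS satF ntD prD hypD.
apply: (supersolvable_of_order_n p_pr pS odd_p _ _ _ hypD satF).
- by rewrite cardG_gt1 -proper1G.
- exact/cardSg/proper_sub.
exact: proper_card.
Qed.
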